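(* Let $m\ge n$ be integers and let $V$ be an orthogonal $m\times m$ matrix with rows $v_1,\dots,v_m\in\mathbb{R}^m$. For each $i$ let $w_i\in\mathbb{R}^{m-n}$ be the vector of the last $m-n$ coordinates of $v_i$, and let $M$ be the $(m-n)\times m$ matrix whose $i$-th column is $w_i$ (so $M\,\mathrm{diag}(\lambda_i)\,{}^tM=\sum_i\lambda_iw_i\otimes w_i$). Let $r>1$ and $p_1,\dots,p_m>1$ satisfy $\sum_{i=1}^m1/p_i=n+(m-n)/r$, and let $D=D_{r,p_i}\ge0$ be the largest constant such that for all positive $\lambda_1,\dots,\lambda_m$, $$\det\big(M\,\mathrm{diag}(\lambda_i)\,{}^tM\big)\ge D\prod_{i=1}^m\lambda_i^{r'/p_i'}.$$ Then for all continuous positive integrable functions $f_1,\dots,f_m$ and $F_1,\dots,F_m$ on $\mathbb{R}$ with $\int f_i=\int F_i$ for every $i$, $$\Big[\int_{\mathbb{R}^{m-n}}\Big[\int_{\mathbb{R}^n}\prod_{i=1}^m f_i^{1/p_i}(\langle x,v_i\rangle)\,dx_1\cdots dx_n\Big]^r dx_{n+1}\cdots dx_m\Big]^{1/r}\le D^{-1/r'}\int_{\mathbb{R}^n}\Big[\int_{\mathbb{R}^{m-n}}\prod_{i=1}^m F_i^{r/p_i}(\langle X,v_i\rangle)\,dX_{n+1}\cdots dX_m\Big]^{1/r}dX_1\cdots dX_n,$$ where $x=(x_1,\dots,x_m)$, $X=(X_1,\dots,X_m)$, and $D^{-1/r'}=+\infty$ if $D=0$.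
   Context: For $t>1$, the conjugate exponent $t'$ is defined by $1/t+1/t'=1$. $\mathrm{diag}(\lambda_i)$ is the $m\times m$ diagonal matrix with entries $\lambda_1,\dots,\lambda_m$; ${}^tM$ is the transpose of $M$; $w\otimes w=ww^T$. *)

(* Defs.v *)
From HB Require Import structures.
From mathcomp Require Import all_boot all_order all_algebra.
From mathcomp Require Import all_classical all_reals all_analysis.
Set Implicit Arguments. Unset Strict Implicit. Unset Printing Implicit Defensive.
Import Order.TTheory GRing.Theory Num.Theory.
Local Open Scope ring_scope.
Local Open Scope ereal_scope.

(* Iterated Lebesgue integral over R^k (row vectors 'rV_k): for nonnegative
   measurable functions this equals (Tonelli) the integral w.r.t. Lebesgue
   measure on R^k; coordinate 1 is the outermost integral. *)
Fixpoint iint {R : realType} (k : nat) : ('rV[R]_k -> \bar R) -> \bar R :=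
  match k return ('rV[R]_k -> \bar R) -> \bar R with
  | 0 => fun f => f 0%R
  | k'.+1 => fun f =>
      \int[@lebesgue_measure R]_(t in [set: R])
        iint (fun v : 'rV[R]_k' => f (row_mx (t%:M : 'rV[R]_1) v))
  end.

Definition conj_exp {R : realType} (t : R) : R := (t / (t - 1))%R.

Definition det_ineq {R : realType} (n d : nat) (V : 'M[R]_(n + d))
  (r : R) (p : 'I_(n + d) -> R) (D : R) : Prop :=
  forall lam : 'rV[R]_(n + d), (forall i, 0 < lam 0 i)%R ->
    (D * \prod_(i < n + d) (lam 0 i) `^ (conj_exp r / conj_exp (p i))
      <= \det ((rsubmx V)^T *m diag_mx lam *m rsubmx V))%R.

Definition ip {R : realType} (n d : nat) (V : 'M[R]_(n + d))
  (a : 'rV[R]_n) (b : 'rV[R]_d) (i : 'I_(n + d)) : R :=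
  (\sum_(j < n + d) (row_mx a b) 0 j * V i j)%R.

(* Main.v *)
Require Import Defs.
From HB Require Import structures.
From mathcomp Require Import all_boot all_order all_algebra.
From mathcomp Require Import all_classical all_reals all_analysis measurable_realfun.
From mathcomp Require Import ring lra.
Import Order.TTheory GRing.Theory Num.Theory numFieldNormedType.Exports.
Set Implicit Arguments. Unset Strict Implicit. Unset Printing Implicit Defensive.
Local Open Scope ring_scope.

(* Barthe's transport proof. Let u_i be the increasing bijections of the line with
   f_i(u_i) u_i' = F_i. By duality, the left-hand side is controlled by
   integrals of prod_i f_i^(1/p_i)(<x, v_i>) H(x_(n+1), .., x_m) over R^m, with
   ||H||_r' = 1. Substitute x = Theta(X) = sum_i u_i(<X, v_i>) v_i, whose Jacobian is
   prod_i u_i'(<X, v_i>): the integrand becomes prod_i F_i^(1/p_i) times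
   prod_i (u_i')^(1/p_i') H(Theta(X)_(n+1), ..). For fixed X_1, .., X_n, Hoelder's inequality
   in the last variables separates the two factors. By definition of D, the r'-th power
   of the second one is at most D^-1 times H^r' evaluated along the map
   (X_(n+1), .., X_m) |-> sum_i u_i(<X, v_i>) w_i and multiplied by the Jacobian of that
   map, so a second change of variables bounds its integral by D^-1. *)

(** The delicate point is the change of variables in several dimensions, for maps whose components
    [u_i] are merely C^1. Both maps that occur are of the form y |-> sum_i u_i(c_i + <y, A_i>) A_i,
    where the matrix with rows A_i has orthonormal columns. The difference of two values of such a
    map is the difference of the arguments times a matrix A^T diag(slopes) A. As each u_i increases,
    these slopes are positive and the matrix is positive definite, even for distant arguments. This
    global positivity replaces local inversion: the variables are eliminated one at a time, each by
    a substitution on the line, and positivity passes to Schur complements. The dual function is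
    written H = t^(1/r') with t positive of finite integral, so that H^r' is t itself. *)

(** * Iterated integrals *)

(* 'rV[R]_k carries no sigma-algebra here: a function on it is called measurable
   when its composition with every family of rows with measurable coordinates
   is measurable. *)
Definition param_measurable {R : realType} {d d2} {T : measurableType d} {U : measurableType d2}
    {k} (g : T -> 'rV[R]_k -> U) : Prop :=
  forall d' (S : measurableType d') (h : S -> T) (a : S -> 'rV[R]_k),
    measurable_fun setT h -> (forall j, measurable_fun setT (fun s => a s 0 j)) ->
    measurable_fun setT (fun s => g (h s) (a s)).

Definition row_measurable {R : realType} {d2} {U : measurableType d2}
    {k} (g : 'rV[R]_k -> U) : Prop :=
  forall d' (S : measurableType d') (a : S -> 'rV[R]_k),
    (forall j, measurable_fun setT (fun s => a s 0 j)) ->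
    measurable_fun setT (g \o a).

Section iint_theory.
Context {R : realType}.
Notation mu := (@lebesgue_measure R).

Lemma row_mx_scalarE k (t : R) (v : 'rV[R]_k) j :
  row_mx (t%:M : 'rV[R]_1) v 0 j = if unlift 0 j is Some i then v 0 i else t.
Proof.
rewrite mxE; case: splitP => i ji.
  have -> : j = 0 by apply/val_inj; rewrite /= ji ord1.
  by rewrite unlift_none ord1 mxE eqxx mulr1n.
have -> : j = lift 0 i by apply/val_inj; rewrite /= ji.
by rewrite liftK.
Qed.

Lemma measurable_row_mx_scalar d (S : measurableType d) k (s : S -> R)
    (a : S -> 'rV[R]_k) :
  measurable_fun setT s -> (forall j, measurable_fun setT (fun x => a x 0 j)) ->
  forall j, measurable_fun setT (fun x => row_mx ((s x)%:M : 'rV[R]_1) (a x) 0 j).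
Proof.
move=> ms ma j; under eq_fun do rewrite row_mx_scalarE.
by case: (unlift 0 j) => [i|]; [exact: ma|exact: ms].
Qed.

Lemma param_row_measurable d (T : measurableType d) d2 (U : measurableType d2) k
    (g : T -> 'rV[R]_k -> U) t : param_measurable g -> row_measurable (g t).
Proof. by move=> mg d' S a ma; apply: (mg _ S (cst t) a). Qed.

Lemma row_param_measurable d (T : measurableType d) d2 (U : measurableType d2) k
    (g : 'rV[R]_k -> U) : row_measurable g -> param_measurable (fun _ : T => g).
Proof. by move=> mg d' S h a mh ma; apply: (mg _ S a). Qed.

Lemma row_measurable_cons d2 (U : measurableType d2) k (g : 'rV[R]_k.+1 -> U) :
  row_measurable g ->
  param_measurable (fun (t : R) (v : 'rV[R]_k) => g (row_mx (t%:M : 'rV[R]_1) v)).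
Proof.
move=> mg d' S h a mh ma.
by apply: (mg _ S (fun s => row_mx ((h s)%:M : 'rV[R]_1) (a s))); exact: measurable_row_mx_scalar.
Qed.

Lemma param_measurable_cons d (T : measurableType d) d2 (U : measurableType d2) k
    (g : T -> 'rV[R]_k.+1 -> U) :
  param_measurable g -> param_measurable (fun (ts : T * R) (v : 'rV[R]_k) =>
                      g ts.1 (row_mx (ts.2%:M : 'rV[R]_1) v)).
Proof.
move=> mg d' S h a mh ma; apply: (mg _ S (fun s => (h s).1)
  (fun s => row_mx ((h s).2%:M : 'rV[R]_1) (a s))).
  exact: measurableT_comp.
by apply: measurable_row_mx_scalar => //; exact: measurableT_comp.
Qed.

Local Open Scope ereal_scope.

Lemma eq_iint k (g h : 'rV[R]_k -> \bar R) : g =1 h -> iint g = iint h.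
Proof. by move/funext ->. Qed.

Lemma iint_ge0 k (g : 'rV[R]_k -> \bar R) : (forall v, 0 <= g v) -> 0 <= iint g.
Proof.
elim: k g => [|k IH] g g0 /=; first exact: g0.
by apply: integral_ge0 => t _; exact: IH.
Qed.

(** The parameter space is arbitrary so that the induction can move a coordinate into it: the inner
    integral is measurable on [T * R], and Tonelli integrates out the last factor. *)
Lemma measurable_iint d (T : measurableType d) k (g : T -> 'rV[R]_k -> \bar R) :
  (forall t v, 0 <= g t v) -> param_measurable g -> measurable_fun setT (fun t => iint (g t)).
Proof.
elim: k d T g => [|k IH] d T g g0 mg /=.
  by apply: (mg _ T id (fun=> 0%R)) => // j; exact: measurable_cst.
have := @measurable_fun_fubini_tonelli_F _ _ T (measurableTypeR R) R mu
  (fun ts => iint (fun v => g ts.1 (row_mx (ts.2%:M : 'rV[R]_1) v))).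
apply.
- apply: (IH _ (T * measurableTypeR R)%type (fun ts v => g ts.1 (row_mx (ts.2%:M : 'rV[R]_1) v))).
  + by move=> *; exact: g0.
  + exact: param_measurable_cons.
- by move=> *; apply: iint_ge0.
Qed.

Lemma param_measurable_iint d (T : measurableType d) j k (g : T -> 'rV[R]_j -> 'rV[R]_k -> \bar R) :
  (forall t v w, 0 <= g t v w) ->
  param_measurable (fun (ta : T) (v : 'rV[R]_(j + k)) => g ta (lsubmx v) (rsubmx v)) ->
  param_measurable (fun t v => iint (g t v)).
Proof.
move=> g0 mg d' S h a mh ma; apply: measurable_iint => // d1 S1 h1 a1 mh1 ma1.
rewrite (_ : (fun s => _) = (fun s => g ((h \o h1) s)
  (lsubmx (row_mx (a (h1 s)) (a1 s))) (rsubmx (row_mx (a (h1 s)) (a1 s))))); last first.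
  by apply/funext => s; rewrite row_mxKl row_mxKr.
apply: (mg _ S1 (h \o h1) (fun s => row_mx (a (h1 s)) (a1 s))).
  exact: measurableT_comp.
move=> i; under eq_fun do rewrite mxE.
by case: (fintype.split i) => // l; exact: (measurableT_comp (ma l) mh1).
Qed.

Lemma row_measurable_iint j k (g : 'rV[R]_j -> 'rV[R]_k -> \bar R) :
  (forall v w, 0 <= g v w) ->
  row_measurable (fun (v : 'rV[R]_(j + k)) => g (lsubmx v) (rsubmx v)) ->
  row_measurable (fun v => iint (g v)).
Proof.
move=> g0 mg; apply: (@param_row_measurable _ unit _ _ _ (fun _ v => iint (g v)) tt).
by apply: param_measurable_iint => //; exact: row_param_measurable.
Qed.

Lemma iint_cons_measurable k (g : 'rV[R]_k.+1 -> \bar R) :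
  (forall v, 0 <= g v) -> row_measurable g ->
  measurable_fun [set: measurableTypeR R]
    (fun t : R => iint (fun v => g (row_mx (t%:M : 'rV[R]_1) v))).
Proof.
move=> g0 mg; apply: (@measurable_iint _ (measurableTypeR R) k (fun t v => _)) => //.
exact: (row_measurable_cons mg).
Qed.

Lemma row_measurable_cons_fix d2 (U : measurableType d2) k (g : 'rV[R]_k.+1 -> U) (t : R) :
  row_measurable g -> row_measurable (fun v => g (row_mx (t%:M : 'rV[R]_1) v)).
Proof. by move=> /row_measurable_cons/param_row_measurable. Qed.

Lemma le_iint k (g h : 'rV[R]_k -> \bar R) :
  (forall v, 0 <= g v) -> row_measurable g -> row_measurable h -> (forall v, g v <= h v) ->
  iint g <= iint h.
Proof.
elim: k g h => [|k IH] g h g0 mg mh gh /=; first exact: gh.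
have h0 v : 0 <= h v by exact: le_trans (gh v).
apply: ge0_le_integral => //.
- by move=> t _; exact: iint_ge0.
- exact: iint_cons_measurable.
- exact: iint_cons_measurable.
- by move=> t _; apply: IH => //; exact: row_measurable_cons_fix.
Qed.

Lemma iintD k (g h : 'rV[R]_k -> \bar R) :
  (forall v, 0 <= g v) -> (forall v, 0 <= h v) -> row_measurable g -> row_measurable h ->
  iint (fun v => g v + h v) = iint g + iint h.
Proof.
elim: k g h => [//|k IH] g h g0 h0 mg mh /=.
rewrite -ge0_integralD //; last first.
- exact: iint_cons_measurable.
- by move=> t _; exact: iint_ge0.
- exact: iint_cons_measurable.
- by move=> t _; exact: iint_ge0.
by apply: eq_integral => t _; rewrite IH//; exact: row_measurable_cons_fix.
Qed.

Lemma iintZl k (c : R) (g : 'rV[R]_k -> \bar R) :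
  (0 <= c)%R -> (forall v, 0 <= g v) -> row_measurable g ->
  iint (fun v => c%:E * g v) = c%:E * iint g.
Proof.
move=> c0; elim: k g => [//|k IH] g g0 mg /=.
rewrite -ge0_integralZl//; last 2 first.
- exact: iint_cons_measurable.
- by move=> t _; exact: iint_ge0.
by apply: eq_integral => t _; rewrite IH//; exact: row_measurable_cons_fix.
Qed.

(** Moves a line variable past a block of coordinates. Iterating it gives [iint_exchange]; it also
    brings the first coordinate innermost in [iint_slope_map]. *)
Lemma iint_integral_exchange k (g : R -> 'rV[R]_k -> \bar R) :
  (forall t v, 0 <= g t v) -> param_measurable g ->
  \int[mu]_t iint (g t) = iint (fun v => \int[mu]_t g t v).
Proof.
elim: k g => [//|k IH] g g0 mg /=.
have mg2 := param_measurable_cons mg.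
have := @fubini_tonelli _ _ (measurableTypeR R) (measurableTypeR R) R mu mu
  (fun ts => iint (fun v => g ts.1 (row_mx (ts.2%:M : 'rV[R]_1) v))).
rewrite /fubini_F /fubini_G /= => ->.
- apply: eq_integral => s _; apply: IH => // d' S h a mh ma.
  by apply: (mg _ S h (fun x => row_mx (s%:M : 'rV[R]_1) (a x))) => //;
    exact: measurable_row_mx_scalar.
- by apply: (@measurable_iint _ (measurableTypeR R * measurableTypeR R)%type k
    (fun ts v => g ts.1 (row_mx (ts.2%:M : 'rV[R]_1) v))).
- by move=> *; exact: iint_ge0.
Qed.

(** Associativity of concatenation, well typed because [j.+1 + k] and [(j + k).+1] are convertible.
    It lets an induction on the left block peel off the first coordinate of the whole row. *)
Lemma row_mx_scalar_cat j k (t : R) (a : 'rV[R]_j) (b : 'rV[R]_k) :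
  row_mx (row_mx (t%:M : 'rV[R]_1) a : 'rV[R]_j.+1) b =
  row_mx (t%:M : 'rV[R]_1) (row_mx a b) :> 'rV[R]_(j + k).+1.
Proof.
apply/rowP => i; rewrite row_mx_scalarE mxE; case: splitP => l il.
  rewrite row_mx_scalarE; case: unliftP => [l'|] ll.
    have -> : i = lift ord0 (lshift k l') by apply/val_inj; rewrite /= il ll.
    by rewrite liftK row_mxEl.
  have -> : i = ord0 by apply/val_inj; rewrite /= il ll.
  by rewrite unlift_none.
have -> : i = lift ord0 (rshift j l) by apply/val_inj; rewrite /= il.
by rewrite liftK row_mxEr.
Qed.

Lemma row_mx0l k (a : 'rV[R]_0) (b : 'rV[R]_k) : row_mx a b = b :> 'rV[R]_k.
Proof.
by apply/rowP => i; rewrite -[RHS](row_mxEr a b); congr (row_mx _ _ _ _); exact/val_inj.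
Qed.

Lemma iint_split j k (g : 'rV[R]_(j + k) -> \bar R) :
  iint g = iint (fun a : 'rV[R]_j => iint (fun b => g (row_mx a b))).
Proof.
elim: j g => [|j IH] g /=.
  by apply: eq_iint => b; rewrite row_mx0l.
apply: eq_integral => t _; rewrite IH.
by do 2 apply: eq_iint => ?; rewrite row_mx_scalar_cat.
Qed.

Lemma iint_exchange j k (g : 'rV[R]_j -> 'rV[R]_k -> \bar R) :
  (forall v w, 0 <= g v w) ->
  row_measurable (fun v : 'rV[R]_(j + k) => g (lsubmx v) (rsubmx v)) ->
  iint (fun v => iint (g v)) = iint (fun w => iint (g^~ w)).
Proof.
elim: j g => [//|j IH] g g0 mg /=.
have mg2 : param_measurable (fun (t : R) (v : 'rV[R]_(j + k)) =>
    g (row_mx (t%:M : 'rV[R]_1) (lsubmx v)) (rsubmx v)).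
  move=> d' S h a mh ma.
  rewrite (_ : (fun s => _) = (fun v : 'rV[R]_(j.+1 + k) => g (lsubmx v) (rsubmx v)) \o
      (fun s => row_mx ((h s)%:M : 'rV[R]_1) (a s))); last first.
    apply/funext => s /=; rewrite -[a s in RHS]hsubmxK -row_mx_scalar_cat.
    by rewrite row_mxKl row_mxKr.
  by apply: mg; exact: measurable_row_mx_scalar.
rewrite -(iint_integral_exchange (g := fun t w =>
  iint (fun v => g (row_mx (t%:M : 'rV[R]_1) v) w))); last 2 first.
- by move=> *; exact: iint_ge0.
- have := @param_measurable_iint _ R k j (fun t w v => g (row_mx (t%:M : 'rV[R]_1) v) w).
  apply => //.
  move=> d' S h a mh ma.
  have := mg2 _ S h (fun s => row_mx (rsubmx (a s)) (lsubmx (a s) : 'rV_k)) mh.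
  rewrite (_ : (fun s => g _ _) = (fun s => g (row_mx (h s)%:M (rsubmx (a s))) (lsubmx (a s)))).
    apply => l; under eq_fun do rewrite mxE.
    by case: (fintype.split l) => i; under eq_fun do rewrite mxE; exact: ma.
  by apply/funext => s; rewrite row_mxKl row_mxKr.
apply: eq_integral => t _; rewrite IH//; exact: param_row_measurable mg2.
Qed.

(** In each coordinate, a positive function with zero integral would vanish almost everywhere, and
    the whole line would be a null set. *)
Lemma iint_gt0 k (g : 'rV[R]_k -> \bar R) :
  (forall v, 0 < g v) -> row_measurable g -> 0 < iint g.
Proof.
elim: k g => [|k IH] g g0 mg /=; first exact: g0.
rewrite lt0e integral_ge0 ?andbT; last by move=> t _; apply/ltW/IH => //; exact: row_measurable_cons_fix.
apply/eqP => I0.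
have h0 t : 0 < iint (fun v => g (row_mx (t%:M : 'rV[R]_1) v)).
  by apply: IH => //; exact: row_measurable_cons_fix.
have [|] := @ae_eq_integral_abs _ (measurableTypeR R) R mu setT measurableT
  (fun t => iint (fun v => g (row_mx (t%:M : 'rV[R]_1) v))).
  by apply: iint_cons_measurable => // v; exact: ltW.
move=> /[swap] _ [|N [mN N0 sN]].
  by rewrite -[RHS]I0; apply: eq_integral => t _; rewrite gee0_abs// ltW.
have NT : N = setT.
  rewrite -subTset => t _; apply: sN => /= /(_ Logic.I) t0.
  by have := h0 t; rewrite t0 ltxx.
have := @lebesgue_measure_itv R `]-oo, +oo[.
by rewrite set_itvNyy => muT; move: N0; rewrite NT => /(etrans (esym muT)).
Qed.

Lemma iint_monotone_convergence k (g : nat -> 'rV[R]_k -> \bar R) :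
  (forall n v, 0 <= g n v) -> (forall n, row_measurable (g n)) ->
  (forall v, nondecreasing_seq (g^~ v)) ->
  iint (fun v => limn (g^~ v)) = limn (fun n => iint (g n)).
Proof.
elim: k g => [//|k IH] g g0 mg gnd /=.
rewrite -monotone_convergence//.
- by apply: eq_integral => t _; rewrite IH// => n; exact: row_measurable_cons_fix.
- by move=> n; exact: iint_cons_measurable.
- by move=> n t _; exact: iint_ge0.
- move=> t _ m n mn; apply: le_iint => //; try exact: row_measurable_cons_fix.
  by move=> v; exact: gnd.
Qed.
End iint_theory.

(** * Change of variables on the line *)

Lemma deriv_gt0_lt {R : realType} (f df : R -> R) :
  (forall x : R, is_derive x 1%R f (df x)) -> (forall x, 0 < df x) ->
  {mono f : x y / x < y}.
Proof.
move=> fdf df0; apply: leW_mono; apply: le_mono => x y xy.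
have cf : continuous f.
  by move=> z; apply/differentiable_continuous/derivable1_diffP; case: (fdf z).
apply: (@gtr0_derive1_incr R f x y) => //.
- by move=> z _; rewrite derive1E (@derive_val _ _ _ _ _ _ _ (fdf z)).
- exact: continuous_subspaceT.
Qed.

Section substitution.
Context {R : realType}.
Notation mu := (@lebesgue_measure R).
Local Open Scope ereal_scope.
Import HBNNSimple.

(** The hypothesis [m1E] is the case of indicators. Linearity extends it to simple functions, and
    monotone convergence along [nnsfun_approx] on both sides gives the rest. *)
Lemma ge0_integral_density d (T : measurableType d)
    (m m1 : {measure set T -> \bar R}) (w : T -> R) (f : T -> \bar R) :
  measurable_fun setT w -> (forall x, (0 <= w x)%R) ->
  (forall A, measurable A -> m1 A = \int[m]_(x in A) (w x)%:E) ->
  measurable_fun setT f -> (forall x, 0 <= f x) ->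
  \int[m1]_x f x = \int[m]_x (f x * (w x)%:E).
Proof.
move=> mw' w0 m1E mf f0.
have mw : measurable_fun setT (fun x => (w x)%:E) by exact/measurable_EFinP.
pose h := nnsfun_approx measurableT mf.
have fE x : f x = limn (fun n => (h n x)%:E).
  by apply/esym/cvg_lim => //; apply: cvg_nnsfun_approx => //.
have hnd x : nondecreasing_seq (fun n => (h n x)%:E).
  by move=> a b ab; rewrite lee_fin; exact/lefP/nd_nnsfun_approx.
transitivity (limn (fun n => \int[m1]_x (h n x)%:E)).
  under eq_integral do rewrite fE.
  apply: monotone_convergence => //.
  - by move=> n; apply/measurable_EFinP; exact: measurable_funP.
  - by move=> n x _; rewrite lee_fin.
have mhw n : measurable_fun setT (fun x => (h n x)%:E * (w x)%:E).
  by apply: emeasurable_funM => //; apply/measurable_EFinP; exact: measurable_funP.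
transitivity (limn (fun n => \int[m]_x ((h n x)%:E * (w x)%:E))); last first.
  rewrite -monotone_convergence//.
  - apply: eq_integral => x _; rewrite fE.
    apply/cvg_lim => //; apply: cvgeZr => //; rewrite -fE.
    exact: cvg_nnsfun_approx.
  - by move=> n x _; rewrite mule_ge0// lee_fin//.
  - by move=> x _ a b ab; apply: lee_wpmul2r; [rewrite lee_fin|exact: hnd].
congr (limn _); apply/funext => n.
rewrite integralT_nnsfun sintegralE.
transitivity (\int[m]_x (\sum_(y \in range (h n))
  ((y%:E * (\1_(h n @^-1` [set y]) x)%:E) * (w x)%:E))).
  rewrite ge0_integral_fsum//; last 2 first.
  - move=> y; apply: emeasurable_funM => //.
    by apply/measurable_EFinP; apply: measurable_funM.
  - by move=> y x _; apply: mule_ge0; [exact: nnfun_muleindic_ge0|rewrite lee_fin].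
  apply: eq_fsbigr => y; rewrite inE => -[z _ <-].
  under eq_integral do rewrite -muleA.
  rewrite ge0_integralZl//; last 3 first.
  - by apply: emeasurable_funM => //; apply/measurable_EFinP.
  - by move=> x _; rewrite mule_ge0// lee_fin//.
  - by rewrite lee_fin.
  rewrite m1E// integral_mkcond; congr (_ * _); apply: eq_integral => x _.
  by rewrite epatch_indic/= muleC.
apply: eq_integral => x _; rewrite (fimfunE (h n) x) -fsumEFin// ge0_mule_fsuml//.
by move=> y; exact: nnfun_muleindic_ge0.
Qed.
(* The image under phi of the measure with density dphi agrees with Lebesgue
   measure on intervals, hence g need not be continuous. *)
Lemma ge0_integration_by_substitution_bij (phi dphi : R -> R) (g : R -> \bar R) :
  (forall x : R, is_derive x 1%R phi (dphi x)) -> continuous dphi ->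
  (forall x, (0 < dphi x)%R) -> (forall t, exists x, phi x = t) ->
  measurable_fun setT g -> (forall t, 0 <= g t) ->
  \int[mu]_x (g (phi x) * (dphi x)%:E) = \int[mu]_t g t.
Proof.
move=> dp cdphi dphi0 surj mg g0.
have cphi : continuous phi.
  by move=> x; apply/differentiable_continuous/derivable1_diffP; case: (dp x).
have phi_ltE := deriv_gt0_lt dp dphi0.
have mphi : measurable_fun [set: measurableTypeR R] (phi : _ -> measurableTypeR R).
  exact: continuous_measurable_fun.
have mdphi : measurable_fun [set: measurableTypeR R] dphi.
  by exact: continuous_measurable_fun.
have dphi_ge0 x : 0 <= (dphi x)%:E by rewrite lee_fin ltW.
pose nu0 (A : set (measurableTypeR R)) := \int[mu]_(x in A) (dphi x)%:E.
have nu00 : nu0 set0 = 0 by rewrite /nu0 integral_set0.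
have nu0_ge0 A : 0 <= nu0 A by exact: integral_ge0.
have nu0_add : semi_sigma_additive nu0.
  by apply: semi_sigma_additive_nng_induced => //; exact/measurable_EFinP.
pose nu : {measure set (measurableTypeR R) -> \bar R} :=
  HB.pack nu0 (isMeasure.Build _ _ _ nu0 nu00 nu0_ge0 nu0_add).
pose phiM : {mfun (measurableTypeR R) >-> (measurableTypeR R)} :=
  HB.pack (phi : measurableTypeR R -> measurableTypeR R) (isMeasurableFun.Build _ _ _ _ _ mphi).
have pushE (A : set (measurableTypeR R)) : measurable A ->
    pushforward nu (phiM : measurableTypeR R -> measurableTypeR R) A = mu A.
  move=> mA; apply/esym/lebesgue_measure_unique => // X [[a b]] _ <-.
  rewrite lebesgue_measure_itv/= /pushforward/= /nu0 /=.
  (* Surjectivity and monotonicity make the preimage of ]a, b] an interval with endpoints [al] and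
     [be], whose mass is [phi be - phi al] by the fundamental theorem of calculus. *)
  have [al al_a] := surj a; have [be be_b] := surj b.
  have -> : (phi @^-1` (`]a, b]%classic   : set R))%classic = `]al, be]%classic.
    apply/seteqP; split => x /=; rewrite !in_itv/= -al_a -be_b !leNgt !phi_ltE//.
  rewrite lte_fin -al_a -be_b phi_ltE; case: ifPn => [albe|].
    rewrite integral_itv_obnd_cbnd; last by apply/measurable_EFinP; exact: measurable_funTS.
    rewrite (@continuous_FTC2 _ _ phi)//.
    - exact: continuous_subspaceT.
    - by split; [move=> x _; case: (dp x)|apply: cvg_at_right_filter; exact: cphi|
        apply: cvg_at_left_filter; exact: cphi].
    - by move=> x _; rewrite derive1E (@derive_val _ _ _ _ _ _ _ (dp x)).
  by rewrite -leNgt => beal; rewrite set_itv_ge ?integral_set0// bnd_simp -leNgt.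
transitivity (\int[nu]_x (g \o phi) x).
  apply/esym; apply: ge0_integral_density => //.
  - exact: (measurableT_comp mg mphi).
  - by move=> x; exact: g0.
have := @ge0_integral_pushforward _ _ (measurableTypeR R) (measurableTypeR R) R
  phi mphi nu setT g measurableT mg
  (fun t _ => g0 t).
rewrite preimage_setT => <-.
by apply: eq_measure_integral => A mA _; exact: pushE.
Qed.
End substitution.

(** * Change of variables in R^k *)

Section slope_map_theory.
Context {R : realType}.
Notation mu := (@lebesgue_measure R).
Local Open Scope classical_set_scope.

Definition rdot k (x y : 'rV[R]_k) : R := \sum_j x 0 j * y 0 j.

(** Only the quadratic form is constrained; [q] may be nonsymmetric. This is enough to pass to Schur
    complements and to make the determinant positive. *)
Definition posdef k (q : 'M[R]_k) : Prop := forall h, h != 0 -> 0 < rdot (h *m q) h.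

(* Q y z is a slope of Phi between y and z, so that Q y y is the (transposed)
   Jacobian matrix of Phi at y. Asking for positivity for all pairs (y, z) and for
   coercivity around every point Z makes the class stable under freezing one
   coordinate of the image. *)
Record slope_map k (Phi : 'rV[R]_k -> 'rV[R]_k)
    (Q : 'rV[R]_k -> 'rV[R]_k -> 'M[R]_k) : Prop := SlopeMap {
  slopeE : forall y z, Phi z - Phi y = (z - y) *m Q y z;
  slope_pos : forall y z, posdef (Q y z);
  slope_cont : forall y i j, Q y z i j @[z --> y] --> Q y y i j;
  slope_diag_cont : forall y i j, Q z z i j @[z --> y] --> Q y y i j;
  slope_map_measurable : forall i, row_measurable (fun y => Phi y 0 i);
  slope_diag_measurable : forall i j, row_measurable (fun y => Q y y i j);
  slope_coercive : forall Z C, exists rho, forall Y, rho <= `|Y| ->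
    C * `|Y| <= rdot (Phi Y) (Y - Z) }.

Definition row_cons k (t : R) (v : 'rV[R]_k) : 'rV[R]_k.+1 :=
  row_mx (t%:M : 'rV[R]_1) v.

Lemma row_consE k (t : R) (v : 'rV[R]_k) j :
  row_cons t v 0 j = if unlift 0 j is Some i then v 0 i else t.
Proof. exact: row_mx_scalarE. Qed.

Lemma rdot_cons k (s t : R) (x y : 'rV[R]_k) :
  rdot (row_cons s x) (row_cons t y) = s * t + rdot x y.
Proof.
rewrite /rdot big_ord_recl !row_consE unlift_none; congr (_ + _).
by apply: eq_bigr => i _; rewrite !row_consE liftK.
Qed.

Lemma rdot0r k (x : 'rV[R]_k) : rdot x 0 = 0.
Proof. by rewrite /rdot big1// => i _; rewrite mxE mulr0. Qed.

Lemma row_consK k (x : 'rV[R]_k.+1) :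
  row_cons (x 0 0) (rsubmx (x : 'rV_(1 + k))) = x.
Proof.
apply/rowP => i; rewrite row_consE; case: unliftP => [j|] -> //.
by rewrite mxE; congr (x _ _); apply/val_inj.
Qed.

(** * Sup norm and coordinatewise limits of rows *)

Lemma norm_mxE m n (M : 'M[R]_(m, n)) :
  `|M| = \big[Num.max/0]_ij `|M ij.1 ij.2|.
Proof. exact: mx_normrE. Qed.

Lemma le_entry_mx_norm m n (M : 'M[R]_(m, n)) i j : `|M i j| <= `|M|.
Proof.
rewrite norm_mxE; apply: (le_bigmax_cond _ (j := (i, j))) => //.
Qed.

Lemma cvg_row k (T : Type) (F : set_system T) (FF : Filter F)
    (f : T -> 'rV[R]_k) (l : 'rV[R]_k) :
  (forall j, f x 0 j @[x --> F] --> l 0 j) -> f x @[x --> F] --> l.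
Proof.
move=> h; apply/cvgrPdist_lt => e e0.
have : \forall x \near F, forall j : 'I_k, `|l 0 j - f x 0 j| < e.
  apply: filter_forall => j; have /cvgrPdist_lt := h j; exact.
apply: filterS => x hx; rewrite norm_mxE.
by apply: bigmax_lt => // -[i j] _ /=; rewrite ord1 !mxE.
Qed.

Lemma norm_cons_ge_head k t (v : 'rV[R]_k) : `|t| <= `|row_cons t v|.
Proof.
by have := le_entry_mx_norm (row_cons t v) 0 0; rewrite row_consE unlift_none.
Qed.

Lemma norm_cons_ge_tail k t (v : 'rV[R]_k) : `|v| <= `|row_cons t v|.
Proof.
rewrite norm_mxE; apply: bigmax_le => // -[i j] _ /=.
by have := le_entry_mx_norm (row_cons t v) i (lift 0 j); rewrite ord1 row_consE liftK.
Qed.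

Lemma cvg_cons k (T : Type) (F : set_system T) (FF : Filter F)
    (f : T -> R) (g : T -> 'rV[R]_k) (l : R) (m : 'rV[R]_k) :
  f x @[x --> F] --> l -> g x @[x --> F] --> m ->
  row_cons (f x) (g x) @[x --> F] --> row_cons l m.
Proof.
move=> fl gm; apply: cvg_row => j; under eq_fun do rewrite row_consE.
rewrite row_consE; case: (unlift 0 j) => [i|//].
apply: (@continuous_cvg _ _ _ _ _ g (fun M : 'rV[R]_k => M 0 i) m) => //.
exact: coord_continuous.
Qed.

Lemma cvg_sumr (T I : Type) (F : set_system T) (FF : Filter F) (r : seq I)
    (f : I -> T -> R) (l : I -> R) :
  (forall i, f i x @[x --> F] --> l i) ->
  \sum_(i <- r) f i x @[x --> F] --> \sum_(i <- r) l i.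
Proof.
move=> cf; elim: r => [|i r IH].
  by rewrite big_nil; under eq_fun do rewrite big_nil; exact: cvg_cst.
by rewrite big_cons; under eq_fun do rewrite big_cons; exact: cvgD.
Qed.

Lemma slope_map_continuous k (Phi : 'rV[R]_k -> 'rV[R]_k) Q :
  slope_map Phi Q -> forall y i, Phi z 0 i @[z --> y] --> Phi y 0 i.
Proof.
move=> H y i.
have -> : (fun z => Phi z 0 i) = (fun z => Phi y 0 i + \sum_j (z 0 j - y 0 j) * Q y z j i).
  apply/funext => z; have /rowP/(_ i) := slopeE H y z.
  rewrite !mxE => /eqP; rewrite subr_eq addrC => /eqP ->; congr (_ + _).
  by apply: eq_bigr => j _; rewrite !mxE.
rewrite -[X in _ --> X]addr0; apply: (cvgD (F := nbhs y)); first exact: cvg_cst.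
rewrite [X in _ --> X](_ : 0 = \sum_j (y 0 j - y 0 j) * Q y y j i); last first.
  by rewrite big1// => j _; rewrite subrr mul0r.
apply: (cvg_sumr (F := nbhs y)) => j; apply: (cvgM (F := nbhs y)); last exact: (slope_cont H).
by apply: (cvgB (F := nbhs y)); [exact: coord_continuous|exact: cvg_cst].
Qed.

(** * Schur complements of positive matrices *)

Definition schur k (q : 'M[R]_k.+1) : 'M[R]_k :=
  \matrix_(i, j) (q (lift 0 i) (lift 0 j) - q (lift 0 i) 0 * q 0 (lift 0 j) / q 0 0).

Lemma block_scalarE k (q : 'M[R]_k.+1) :
  q = block_mx (q 0 0)%:M (\row_j q 0 (lift 0 j)) (\col_i q (lift 0 i) 0)
        (\matrix_(i, j) q (lift 0 i) (lift 0 j)) :> 'M[R]_(1 + k).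
Proof.
rewrite -[LHS](@submxK _ 1 k 1 k); congr block_mx; apply/matrixP => i j;
  rewrite !mxE ?ord1 ?eqxx ?mulr1n; congr (q _ _); exact/val_inj.
Qed.

Lemma det_schur k (q : 'M[R]_k.+1) : q 0 0 != 0 -> \det q = q 0 0 * \det (schur q).
Proof.
(* Multiplication by the unit lower triangular [L] is one step of Gaussian elimination: it clears
   the first column below [q 0 0]. *)
move=> q0; pose L : 'M[R]_(1 + k) := block_mx 1%:M 0 (\col_i (- (q (lift 0 i) 0 / q 0 0))) 1%:M.
have : \det (L *m (q : 'M[R]_(1 + k))) = q 0 0 * \det (schur q).
  rewrite [X in L *m X]block_scalarE mulmx_block !mul1mx !mul0mx !addr0.
  rewrite (_ : _ *m (q 0 0)%:M + _ = 0); last first.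
    apply/matrixP => i j; rewrite mul_mx_scalar !mxE.
    by rewrite mulrN mulrCA divff// mulr1 addNr.
  rewrite (_ : _ + \matrix_(_, _) _ = schur q); last first.
    apply/matrixP => i j; rewrite !mxE big_ord1 !mxE addrC mulNr.
    by congr (_ - _); rewrite mulrAC.
  by rewrite det_ublock det_scalar expr1.
by rewrite det_mulmx det_lblock !det1 !mul1r.
Qed.

Lemma mulmx_consE k (q : 'M[R]_k.+1) (t : R) (v : 'rV[R]_k) j :
  (row_cons t v *m q) 0 j = t * q 0 j + \sum_i v 0 i * q (lift 0 i) j.
Proof.
rewrite mxE big_ord_recl row_consE unlift_none; congr (_ + _).
by apply: eq_bigr => i _; rewrite row_consE liftK.
Qed.

(** The vanishing of the first coordinate determines [t] from [v]; inserting this value in the other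
    coordinates produces the correction term of the Schur complement. *)
Lemma mulmx_schur k (q : 'M[R]_k.+1) (t : R) (v : 'rV[R]_k) : q 0 0 != 0 ->
  (row_cons t v *m q) 0 0 = 0 ->
  row_cons t v *m q = row_cons 0 (v *m schur q).
Proof.
move=> q0 h0; apply/rowP => j; rewrite [RHS]row_consE.
case: unliftP => [i|] ->; last exact: h0.
move: h0; rewrite !mulmx_consE => /eqP; rewrite addr_eq0 => /eqP h0.
rewrite mxE; under [RHS]eq_bigr do rewrite mxE mulrBr.
rewrite sumrB addrC; congr (_ + _).
rewrite (eq_bigr (fun i' => v 0 i' * q (lift 0 i') 0 * (q 0 (lift 0 i) / q 0 0))).
  by rewrite -mulr_suml -[X in - (X * _)]opprK -h0; field.
by move=> i' _; rewrite !mulrA.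
Qed.

Lemma row_consB k s t (x y : 'rV[R]_k) : row_cons s x - row_cons t y = row_cons (s - t) (x - y).
Proof. apply/rowP => j; rewrite row_consE mxE [X in _ + X]mxE !row_consE.
by case: (unlift 0 j) => // i; rewrite !mxE. Qed.

Lemma row_cons_neq0 k s (y : 'rV[R]_k) : (s != 0) || (y != 0) -> row_cons s y != 0.
Proof.
apply: contraLR; rewrite negbK negb_or !negbK => /eqP/rowP h.
apply/andP; split; apply/eqP.
  by have := h 0; rewrite row_consE unlift_none mxE.
by apply/rowP => i; have := h (lift 0 i); rewrite row_consE liftK !mxE.
Qed.

Lemma posdef00 k (q : 'M[R]_k.+1) : posdef q -> 0 < q 0 0.
Proof.
have h1 : row_cons 1 (0 : 'rV[R]_k) != 0 by apply: row_cons_neq0; rewrite oner_neq0.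
move=> /(_ _ h1); rewrite -[X in rdot X]row_consK rdot_cons.
rewrite mulmx_consE mul1r mulr1 rdot0r addr0 big1 ?addr0//.
by move=> i _; rewrite mxE mul0r.
Qed.

Lemma posdef_schur k (q : 'M[R]_k.+1) : posdef q -> posdef (schur q).
Proof.
move=> qp h h0; have q0 : q 0 0 != 0 by rewrite gt_eqF// posdef00.
(* Chosen so that the first coordinate of [row_cons s h *m q] vanishes; the form of [q] at
   [row_cons s h] is then that of [schur q] at [h]. *)
pose s := - (\sum_i h 0 i * q (lift 0 i) 0) / q 0 0.
have /qp : row_cons s h != 0 by apply: row_cons_neq0; rewrite h0 orbT.
rewrite mulmx_schur//; last by rewrite mulmx_consE /s mulfVK// addNr.
by rewrite rdot_cons mul0r add0r.
Qed.

Lemma posdef_det k (q : 'M[R]_k) : posdef q -> 0 < \det q.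
Proof.
elim: k q => [|k IH] q qp; first by rewrite det_mx00.
have q0 := posdef00 qp.
by rewrite det_schur ?gt_eqF// mulr_gt0// IH//; exact: posdef_schur.
Qed.

Lemma measurable_det d (S : measurableType d) k (A : S -> 'M[R]_k) :
  (forall i j, measurable_fun setT (fun s => A s i j)) ->
  measurable_fun setT (fun s => \det (A s)).
Proof.
move=> mA; apply: measurable_sum => s; apply: measurable_funM => //.
by apply: measurable_prod => i _; exact: mA.
Qed.

Lemma measurable_inv_gt0 d (S : measurableType d) (f : S -> R) :
  (forall s, 0 < f s) -> measurable_fun setT f -> measurable_fun setT (fun s => (f s)^-1).
Proof.
move=> f0 mf; under eq_fun do rewrite -(powR_inv1 (ltW (f0 _))).
by apply: (measurableT_comp (@measurable_powR R (-1)) mf).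
Qed.

(** * Freezing the first coordinate of the image *)

Section fiber.
Variables (k : nat) (Phi : 'rV[R]_k.+1 -> 'rV[R]_k.+1)
  (Q : 'rV[R]_k.+1 -> 'rV[R]_k.+1 -> 'M[R]_k.+1).
Hypothesis H : slope_map Phi Q.

Let phi (s : R) (y : 'rV[R]_k) : R := Phi (row_cons s y) 0 0.
Let tail (x : 'rV[R]_k.+1) : 'rV[R]_k := rsubmx (x : 'rV[R]_(1 + k)).

Lemma slope00_gt0 x y : 0 < Q x y 0 0.
Proof. by apply: posdef00; exact: (slope_pos H). Qed.

Lemma phi_sub s t y : phi t y - phi s y = (t - s) * Q (row_cons s y) (row_cons t y) 0 0.
Proof.
have /rowP/(_ 0) := slopeE H (row_cons s y) (row_cons t y).
rewrite row_consB subrr mulmx_consE big1 ?addr0; last by move=> i _; rewrite mxE mul0r.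
by rewrite !mxE.
Qed.

Lemma phi_lt y : {mono phi^~ y : s t / s < t}.
Proof.
move=> s t; rewrite -subr_gt0 phi_sub pmulr_lgt0 ?subr_gt0//; exact: slope00_gt0.
Qed.

(** Coercivity around [row_cons 0 y] sees only displacements along the first axis. At distance m it
    forces [phi m y] above [t] and [phi (- m) y] below [t], and the intermediate value theorem
    concludes. *)
Lemma phi_surj t y : exists s, phi s y = t.
Proof.
have [rho hrho] := slope_coercive H (row_cons 0 y) (`|t| + 1).
(* The maximum with 1 makes [m] positive, so that it can be cancelled below. *)
pose m := Num.max rho 1.
have m1 : 1 <= m by rewrite le_max lexx orbT.
have key s : `|s| = m -> (`|t| + 1) * m <= phi s y * s.
  move=> sm; have nm : m <= `|row_cons s y| by rewrite -sm norm_cons_ge_head.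
  have := hrho (row_cons s y); rewrite row_consB subrr subr0 -[X in rdot X]row_consK rdot_cons.
  rewrite rdot0r addr0.
  move=> h; apply: le_trans (h _).
    by rewrite ler_wpM2l// addr_ge0.
  by apply: le_trans nm; rewrite le_max lexx.
have hi : t <= phi m y.
  have := key m; rewrite ger0_norm; last by lra.
  move=> /(_ erefl); rewrite ler_pM2r; last lra.
  by have := ler_norm t; lra.
have lo : phi (- m) y <= t.
  have := key (- m); rewrite normrN ger0_norm; last by lra.
  move=> /(_ erefl); rewrite mulrN -mulNr ler_pM2r; last lra.
  by have := ler_norm (- t); rewrite normrN; lra.
have cphi : continuous (phi^~ y).
  move=> s; have c : row_cons x y @[x --> s] --> row_cons s y.
    by apply: (cvg_cons (F := nbhs s)); [exact: cvg_id|exact: cvg_cst].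
  exact: (cvg_comp (fun s => row_cons s y) (fun x => Phi x 0 0) c
    (@slope_map_continuous _ _ _ H _ _)).
have [|||s _ st] := @IVT R (phi^~ y) (- m) m t.
- lra.
- exact: continuous_subspaceT.
- by rewrite ge_min le_max lo hi orbT.
by exists s.
Qed.

(* fiber t y is the first coordinate that a point with remaining coordinates y
   must have for its image to have first coordinate t. *)
Definition fiber (t : R) (y : 'rV[R]_k) : R := sval (cid (phi_surj t y)).

Lemma phi_fiber t y : phi (fiber t y) y = t.
Proof. by rewrite /fiber; case: cid. Qed.

Lemma fiber_phi s y : fiber (phi s y) y = s.
Proof.
by case: (ltgtP (fiber (phi s y) y) s) => // +; rewrite -(phi_lt y) phi_fiber ltxx.
Qed.

Lemma fiber_lt s t y : (fiber t y < s) = (t < phi s y).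
Proof. by rewrite -(phi_lt y) phi_fiber. Qed.

Lemma fiber_gt s t y : (s < fiber t y) = (phi s y < t).
Proof. by rewrite -(phi_lt y) phi_fiber. Qed.

(** Being within e of [fiber t y] is expressed by two strict inequalities on [phi] at the fixed
    levels [fiber t y - e] and [fiber t y + e]. They hold at y and are open conditions, since each
    [phi s] is continuous. *)
Lemma fiber_continuous t : continuous (fiber t).
Proof.
have cphi s : continuous (phi s).
  move=> y; have c : row_cons s z @[z --> y] --> row_cons s y.
    by apply: (cvg_cons (F := nbhs y)); [exact: cvg_cst|exact: cvg_id].
  exact: (cvg_comp (row_cons s) (fun x => Phi x 0 0) c
    (@slope_map_continuous _ _ _ H _ _)).
move=> y; apply/(@cvgrPdist_lt _ _ _ (nbhs y)) => e e0; near=> z.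
rewrite ltr_distlC; apply/andP; split.
  rewrite fiber_gt; near: z; have /(@cvgr_lt _ _ (nbhs y)) := cphi (fiber t y - e) y; apply.
  by rewrite -[ltRHS](phi_fiber t y) phi_lt gtrBl.
rewrite fiber_lt; near: z; have /(@cvgr_gt _ _ (nbhs y)) := cphi (fiber t y + e) y; apply.
by rewrite -[ltLHS](phi_fiber t y) phi_lt ltrDl.
Unshelve. all: by end_near. Qed.

(** By [fiber_gt], the preimage of a half-line is the set where one measurable function is less than
    another. *)
Lemma fiber_measurable : param_measurable (fun t : R => fiber t).
Proof.
move=> d' S h a mh ma mT; apply: (measurability _ (RGenOInfty.measurableE R)) => //.
move=> /= _ [_ [x ->] <-]; rewrite preimage_itvoy setTI.
rewrite (_ : [set _ | _] = (fun s => phi x (a s) < h s) @^-1` [set true]); last first.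
  by apply/seteqP; split => s /=; rewrite fiber_gt => // ->.
rewrite -[X in measurable X]setTI; apply: measurable_fun_ltr => //.
by apply: (slope_map_measurable H) => j; apply: measurable_row_mx_scalar.
Qed.

Definition fiber_point t y := row_cons (fiber t y) y.
Definition fiber_map t y := tail (Phi (fiber_point t y)).
Definition fiber_slope t y z := schur (Q (fiber_point t y) (fiber_point t z)).

Lemma Phi_fiber t y : Phi (fiber_point t y) = row_cons t (fiber_map t y).
Proof. by rewrite -[LHS]row_consK; congr (row_cons _ _); exact: phi_fiber. Qed.

Lemma fiber_point_continuous t : continuous (fiber_point t).
Proof. by move=> y; apply: (cvg_cons (F := nbhs y)); [exact: fiber_continuous|exact: cvg_id]. Qed.

(* Eliminating the first coordinate turns slopes into their Schur complements:
   no implicit function theorem is needed. *)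
Lemma slope_map_fiber t : slope_map (fiber_map t) (fiber_slope t).
Proof.
have q0 x y : Q x y 0 0 != 0 by rewrite gt_eqF// slope00_gt0.
split.
(* Both image points have first coordinate [t], so the first coordinate of the slope identity is 0,
   as [mulmx_schur] requires. *)
- move=> y z; have := slopeE H (fiber_point t y) (fiber_point t z).
  rewrite !Phi_fiber {3 4}/fiber_point !row_consB subrr => E.
  have := E; rewrite mulmx_schur//; last first.
    by rewrite -E row_consE unlift_none.
  by move=> /(@eq_row_mx _ 1 1 k)[].
- by move=> y z; apply: posdef_schur; exact: (slope_pos H).
- move=> y i j; rewrite /fiber_slope [X in _ --> X]mxE.
  under eq_fun do rewrite mxE.
  have c a b : Q (fiber_point t y) (fiber_point t z) a b @[z --> y] -->
      Q (fiber_point t y) (fiber_point t y) a b.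
    exact: (cvg_comp (fiber_point t) (fun z => Q (fiber_point t y) z a b)
      (@fiber_point_continuous t y) (@slope_cont _ _ _ H _ _ _)).
  apply: (cvgB (F := nbhs y)); first exact: c.
  apply: (cvgM (F := nbhs y)); last by apply: (cvgV (F := nbhs y)) => //; exact: c.
  by apply: (cvgM (F := nbhs y)); exact: c.
- move=> y i j; rewrite /fiber_slope [X in _ --> X]mxE.
  under eq_fun do rewrite mxE.
  have c a b : Q (fiber_point t z) (fiber_point t z) a b @[z --> y] -->
      Q (fiber_point t y) (fiber_point t y) a b.
    exact: (cvg_comp (fiber_point t) (fun z => Q z z a b)
      (@fiber_point_continuous t y) (@slope_diag_cont _ _ _ H _ _ _)).
  apply: (cvgB (F := nbhs y)); first exact: c.
  apply: (cvgM (F := nbhs y)); last by apply: (cvgV (F := nbhs y)) => //; exact: c.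
  by apply: (cvgM (F := nbhs y)); exact: c.
- move=> i d' S a ma; under eq_fun do rewrite /= mxE.
  apply: (slope_map_measurable H) => j; apply: measurable_row_mx_scalar => //.
  by apply: (fiber_measurable (h := cst t)).
- move=> i j d' S a ma; under eq_fun do rewrite /= mxE.
  have m b c : measurable_fun setT (fun s =>
      Q (fiber_point t (a s)) (fiber_point t (a s)) b c).
    apply: (slope_diag_measurable H) => l; apply: measurable_row_mx_scalar => //.
    by apply: (fiber_measurable (h := cst t)).
  apply: measurable_funB; first exact: m.
  apply: measurable_funM; first exact: measurable_funM.
  by apply: measurable_inv_gt0 => // s; exact: slope00_gt0.
(* The first coordinate contributes [t * fiber t y] to the scalar product; the summand |t| in the
   constant absorbs it. *)
- move=> Z C; have [rho hrho] := slope_coercive H (row_cons 0 Z) (`|C| + `|t|).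
  exists rho => y ry.
  have ny : `|y| <= `|fiber_point t y| by exact: norm_cons_ge_tail.
  have nt : `|fiber t y| <= `|fiber_point t y| by exact: norm_cons_ge_head.
  have := hrho _ (le_trans ry ny).
  rewrite Phi_fiber {2}/fiber_point row_consB subr0 rdot_cons.
  have : t * fiber t y <= `|t| * `|fiber_point t y|.
    by rewrite (le_trans (ler_norm _))// normrM ler_wpM2l.
  have : C * `|y| <= `|C| * `|fiber_point t y|.
    by rewrite (le_trans (ler_norm _))// normrM normr_id ler_wpM2l.
  by rewrite mulrDl; lra.
Qed.


Lemma det_fiber_slope t y :
  \det (Q (fiber_point t y) (fiber_point t y)) =
  Q (fiber_point t y) (fiber_point t y) 0 0 * \det (fiber_slope t y y).
Proof. by rewrite det_schur// gt_eqF// slope00_gt0. Qed.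

(** By Caratheodory's criterion: the slope in the first variable is the upper left entry of [Q],
    continuous on the diagonal. *)
Lemma is_derive_phi y (s : R) :
  is_derive s 1%R (phi^~ y) (Q (row_cons s y) (row_cons s y) 0 0).
Proof.
apply/is_derive1_caratheodory; exists (fun z => Q (row_cons s y) (row_cons z y) 0 0).
split => // [z|]; first by rewrite phi_sub mulrC.
have c : row_cons x y @[x --> s] --> row_cons s y.
  by apply: (cvg_cons (F := nbhs s)); [exact: cvg_id|exact: cvg_cst].
exact: (cvg_comp _ (fun x => Q (row_cons s y) x 0 0) c (@slope_cont _ _ _ H _ _ _)).
Qed.

End fiber.


Local Open Scope ereal_scope.

(* Substitute the first coordinate on the line, the others being frozen, then
   apply the induction hypothesis to the fiber maps. *)
Lemma iint_slope_map k (Phi : 'rV[R]_k -> 'rV[R]_k) Q (G : 'rV[R]_k -> \bar R) :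
  slope_map Phi Q -> (forall y, 0 <= G y) -> row_measurable G ->
  iint (fun y => G (Phi y) * (\det (Q y y))%:E) = iint G.
Proof.
elim: k Phi Q G => [|k IH] Phi Q G H G0 mG.
  by rewrite /= det_mx00 mule1; congr (G _); apply/rowP => -[].
have det_gt0 y : (0 < \det (Q y y))%R by apply: posdef_det; exact: (slope_pos H).
(* What remains once t = phi s y is substituted: by [det_schur], the entry [Q 0 0] is the derivative
   used up by dt, and the determinant of the fiber slope is left. *)
pose g t y := G (row_cons t (fiber_map H t y)) * (\det (fiber_slope H t y y))%:E.
have mdet : row_measurable (fun y => \det (Q y y)).
  by move=> d S a ma; apply: measurable_det => i j; apply: (slope_diag_measurable H).
have mGPhi : row_measurable (fun y => G (Phi y) * (\det (Q y y))%:E).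
  move=> d S a ma; apply: emeasurable_funM; last first.
    by apply/measurable_EFinP; exact: mdet.
  by apply: mG => j; exact: (slope_map_measurable H).
have mfp d (S : measurableType d) (h : S -> R) (a : S -> 'rV[R]_k) :
    measurable_fun setT h -> (forall j, measurable_fun setT (fun s => a s 0%R j)) ->
    forall j, measurable_fun setT (fun s => fiber_point H (h s) (a s) 0%R j).
  by move=> mh ma; apply: measurable_row_mx_scalar => //; exact: fiber_measurable.
have gE t y : g t y = G (Phi (fiber_point H t y)) *
    (\det (Q (fiber_point H t y) (fiber_point H t y)) /
     Q (fiber_point H t y) (fiber_point H t y) 0 0)%:E.
  rewrite /g Phi_fiber; congr (_ * _%:E).
  by rewrite det_fiber_slope [X in (X / _)%R]mulrC mulfK// gt_eqF//; exact: (slope00_gt0 H).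
have mg : param_measurable (fun t : R => g t).
  move=> d S h a mh ma; under eq_fun do rewrite gE.
  apply: emeasurable_funM.
    by apply: mG => j; apply: (slope_map_measurable H); exact: mfp.
  apply/measurable_EFinP; apply: measurable_funM; first by apply: mdet; exact: mfp.
  apply: measurable_inv_gt0 => [s|]; first exact: (slope00_gt0 H).
  by apply: (slope_diag_measurable H); exact: mfp.
have g0 t y : 0 <= g t y.
  rewrite gE mule_ge0// lee_fin divr_ge0// ltW//; exact: (slope00_gt0 H).
rewrite -[LHS]/(\int[mu]_s iint (fun y => G (Phi (row_cons s y)) *
  (\det (Q (row_cons s y) (row_cons s y)))%:E)).
rewrite (iint_integral_exchange _ (row_measurable_cons mGPhi)); last first.
  by move=> s y; rewrite mule_ge0// lee_fin ltW.
transitivity (iint (fun y => \int[mu]_t g t y)).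
  apply: eq_iint => y.
  apply: etrans; last apply: (@ge0_integration_by_substitution_bij R
    (fun s => Phi (row_cons s y) 0%R 0%R)
    (fun s => Q (row_cons s y) (row_cons s y) 0%R 0%R) (g^~ y)).
  - apply: eq_integral => s _; rewrite gE /fiber_point fiber_phi -muleA -EFinM.
    by rewrite divfK// gt_eqF//; exact: (slope00_gt0 H).
  - exact: (is_derive_phi H).
  - move=> s; have c : row_cons x y @[x --> s] --> row_cons s y.
      by apply: (cvg_cons (F := nbhs s)); [exact: cvg_id|exact: cvg_cst].
    exact: (cvg_comp _ (fun x => Q x x 0%R 0%R) c (@slope_diag_cont _ _ _ H _ _ _)).
  - by move=> s; exact: (slope00_gt0 H).
  - by move=> t; exact: (phi_surj H).
  - by apply: (mg _ R id (fun=> y)).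
  - by [].
rewrite -iint_integral_exchange//.
apply: eq_integral => t _.
rewrite (IH (fiber_map H t) (fiber_slope H t) (fun v => G (row_cons t v)))//.
- exact: slope_map_fiber.
- exact: row_measurable_cons_fix.
Qed.
End slope_map_theory.

(** * Hoelder's inequality and monotone transport *)

Section hoelder.
Context {R : realType}.
Local Open Scope ereal_scope.

Lemma row_measurable_EFin k (g : 'rV[R]_k -> R) :
  row_measurable g -> row_measurable (fun v => (g v)%:E).
Proof. by move=> mg d S a ma; apply/measurable_EFinP; exact: mg. Qed.

Lemma row_measurable_powR k (g : 'rV[R]_k -> R) p :
  row_measurable g -> row_measurable (fun v => (g v `^ p)%R).
Proof.
move=> mg d S a ma; apply: (measurableT_comp (@measurable_powR R p)); exact: mg.
Qed.

Lemma row_measurableM k (f g : 'rV[R]_k -> R) :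
  row_measurable f -> row_measurable g -> row_measurable (fun v => (f v * g v)%R).
Proof. by move=> mf mg d S a ma; apply: measurable_funM; [exact: mf|exact: mg]. Qed.

Lemma powRV (x y p : R) : (0 < x)%R -> (x `^ p = y)%R -> (x^-1 `^ p = y^-1)%R.
Proof.
move=> x0 xy; have y0 : (0 < y)%R by rewrite -xy powR_gt0.
apply: (mulIf (lt0r_neq0 y0)); rewrite mulVf ?gt_eqF// -{1}xy -powRM ?invr_ge0 ?(ltW x0)//.
by rewrite mulVf ?gt_eqF// powR1.
Qed.

(** A positive bound [B] stands for the integral of g^s, because only an upper bound is available in
    the application; it also makes the normalization by [Bs] legitimate. *)
Lemma iint_hoelder k (f g : 'rV[R]_k -> R) (r s B : R) :
  (0 < r)%R -> (0 < s)%R -> (r^-1 + s^-1 = 1)%R ->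
  (forall v, 0 <= f v)%R -> (forall v, 0 <= g v)%R -> row_measurable f -> row_measurable g ->
  0 < iint (fun v => (f v `^ r)%:E) ->
  (0 < B)%R -> iint (fun v => (g v `^ s)%:E) <= B%:E ->
  iint (fun v => (f v * g v)%:E) <=
    poweR (iint (fun v => (f v `^ r)%:E)) r^-1 * (B `^ s^-1)%:E.
Proof.
move=> r0 s0 rs f0 g0 mf mg.
have mfr := row_measurable_EFin (row_measurable_powR r mf).
have mgs := row_measurable_EFin (row_measurable_powR s mg).
have rV0 : (r^-1 != 0)%R by rewrite invr_neq0// gt_eqF.
(* If the integral of f^r is infinite, the right-hand side is infinite too, because [B] is
   positive. *)
case AE : (iint (fun v => (f v `^ r)%:E)) => [a||] // a0 B0 gB; last first.
  by rewrite poweRyr// gt0_mulye ?leey// lte_fin powR_gt0.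
rewrite lte_fin in a0; rewrite poweR_EFin -EFinM.
set ar := (a `^ r^-1)%R; set Bs := (B `^ s^-1)%R; pose K := (ar * Bs)%R.
have ar0 : (0 < ar)%R by exact: powR_gt0.
have Bs0 : (0 < Bs)%R by exact: powR_gt0.
have K0 : (0 < K)%R by exact: mulr_gt0.
have arr : (ar `^ r = a)%R by rewrite -powRrM mulVf ?gt_eqF// powRr1// ltW.
have Bss : (Bs `^ s = B)%R by rewrite -powRrM mulVf ?gt_eqF// powRr1// ltW.
have young v : (f v * g v <= K / (a * r) * (f v `^ r) + K / (B * s) * (g v `^ s))%R.
  have := @conjugate_powR R (f v / ar)%R (g v / Bs)%R r s.
  rewrite !divr_ge0 ?(ltW ar0) ?(ltW Bs0)// => /(_ isT isT r0 s0 rs).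
  rewrite !powRM// ?invr_ge0 ?(ltW ar0) ?(ltW Bs0)//.
  rewrite (powRV ar0 arr) (powRV Bs0 Bss).
  rewrite -(ler_pM2l K0) => h.
  have -> : (f v * g v = K * (f v / ar * (g v / Bs)))%R.
    by rewrite /K; field; rewrite !gt_eqF.
  apply: (le_trans h); rewrite le_eqVlt; apply/orP; left; apply/eqP.
  by field; rewrite !gt_eqF.
(* Young's inequality, normalized so that both sides integrate to K *)
apply: (@le_trans _ _ (iint (fun v => (K / (a * r))%:E * (f v `^ r)%:E +
    (K / (B * s))%:E * (g v `^ s)%:E))).
  apply: le_iint => //.
  - by move=> v; rewrite lee_fin mulr_ge0.
  - by apply: row_measurable_EFin; exact: row_measurableM.
  - move=> d S h mh; apply: emeasurable_funD.
      by apply: measurable_funeM; exact: mfr.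
    by apply: measurable_funeM; exact: mgs.
have c1 : (0 <= K / (a * r))%R by rewrite divr_ge0 ?mulr_ge0 ?ltW.
have c2 : (0 <= K / (B * s))%R by rewrite divr_ge0 ?mulr_ge0 ?ltW.
rewrite iintD; last 4 first.
- by move=> v; rewrite -EFinM lee_fin mulr_ge0// powR_ge0.
- by move=> v; rewrite -EFinM lee_fin mulr_ge0// powR_ge0.
- by move=> d S h mh; apply: measurable_funeM; exact: mfr.
- by move=> d S h mh; apply: measurable_funeM; exact: mgs.
rewrite !iintZl//; last 2 first.
- by move=> v; rewrite lee_fin powR_ge0.
- by move=> v; rewrite lee_fin powR_ge0.
rewrite AE; apply: (@le_trans _ _ ((K / (a * r))%:E * a%:E + (K / (B * s))%:E * B%:E)).
  by rewrite leeD2l// lee_wpmul2l.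
rewrite -!EFinM -EFinD lee_fin le_eqVlt; apply/orP; left; apply/eqP.
have -> : (K / (a * r) * a + K / (B * s) * B = K * (r^-1 + s^-1))%R.
  by field; rewrite !gt_eqF.
by rewrite rs mulr1.
Qed.
End hoelder.

(** * Monotone transport between two densities *)

Section transport.
Context {R : realType}.
Notation mu := (@lebesgue_measure R).
Local Open Scope classical_set_scope.

(** [C x] is the mass of ]-oo, x]. Strict monotonicity keeps its values off 0 and the total mass;
    continuity of the integral along growing half-lines brings them arbitrarily close to both, and
    the intermediate value theorem fills the gap. *)
Lemma cumulative (f : R -> R) : continuous f -> (forall x, 0 < f x) ->
  mu.-integrable [set: R] (EFin \o f) ->
  exists C : R -> R, [/\ forall x : R, is_derive x 1%R C (f x),
    forall x, 0 < C x < fine (\int[mu]_t (f t)%:E) &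
    forall v, 0 < v < fine (\int[mu]_t (f t)%:E) -> exists x, C x = v].
Proof.
move=> cf f0 intf.
pose C x := (\int[mu]_(t in `]-oo, x]) f t)%R; exists C.
set I := fine _.
have intfS (A : set R) : measurable A -> mu.-integrable A (EFin \o f).
  by move=> mA; exact: integrableS intf.
have mf : measurable_fun [set: R] f by exact: continuous_measurable_fun.
have CE x : (C x)%:E = (\int[mu]_(t in `]-oo, x]) (f t)%:E)%E.
  by rewrite fineK//; apply: integrable_fin_num => //; exact: intfS.
have IE : I%:E = (\int[mu]_t (f t)%:E)%E.
  by rewrite fineK//; apply: integrable_fin_num.
have dC (x : R) : is_derive x 1%R C (f x).
  have [||||d1 d2] := @continuous_FTC1 R f -oo%O x (x + 1).
  - by rewrite ltrDl.
  - exact: intfS.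
  - exact: ltNyr.
  - exact: cf.
  by split; [exact: d1|rewrite -derive1E; exact: d2].
have C_lt := deriv_gt0_lt dC f0.
have C_ge0 x : 0 <= C x.
  by rewrite -lee_fin CE integral_ge0// => t _; rewrite lee_fin ltW.
have C_leI x : C x <= I.
  rewrite -lee_fin CE IE; apply: ge0_subset_integral => //.
  - by apply/measurable_EFinP.
  - by move=> t _; rewrite lee_fin ltW.
have cC : continuous C.
  by move=> z; apply/differentiable_continuous/derivable1_diffP; case: (dC z).
split => //.
  move=> x; rewrite (le_lt_trans (C_ge0 (x - 1))) ?C_lt ?gtrBl//=.
  by rewrite (lt_le_trans _ (C_leI (x + 1)))// C_lt ltrDl.
have ex_gt v : v < I -> exists x, v < C x.
  move=> vI; apply: contrapT => no.
  have Cv x : C x <= v by rewrite leNgt; apply/negP => xv; apply: no; exists x.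
  have := @ge0_nondecreasing_set_cvg_integral _ _ R
    (fun n : nat => `]-oo, n%:R] : set (measurableTypeR R)) (EFin \o f) mu.
  have -> : \bigcup_n (`]-oo, n%:R] : set R) = setT.
    rewrite -subTset => x _; exists (Num.bound `|x|) => //=; rewrite in_itv/=.
    exact/ltW/(le_lt_trans (ler_norm x))/archi_boundP.
  move=> cv; suff : (I%:E <= v%:E)%E by rewrite lee_fin leNgt vI.
  have {}cv : (\int[mu]_(x in `]-oo, i%:R]) (EFin \o f) x)%E @[i --> \oo] --> I%:E.
    rewrite IE; apply: cv => //.
    - by move=> m n mn; apply/subsetPset/subset_itvl; rewrite bnd_simp ler_nat.
    - by move=> n; apply/measurable_EFinP; exact: measurable_funTS.
    - by move=> n x _; rewrite lee_fin ltW.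
  by apply: (cvge_le _ cv); near=> n; rewrite -CE lee_fin.
have ex_lt v : 0 < v -> exists x, C x < v.
  move=> v0; apply: contrapT => no.
  have Cv x : v <= C x by rewrite leNgt; apply/negP => xv; apply: no; exists x.
  (* Near 0 the argument runs on the tails ]-n, +oo[, because these sets increase with n whereas
     ]-oo, -n] decreases. *)
  have tailE x : (\int[mu]_(t in `]x, +oo[) (f t)%:E = (I - C x)%:E)%E.
    rewrite EFinB IE.
    have -> : (\int[mu]_t (f t)%:E =
        \int[mu]_(t in `]-oo, x]) (f t)%:E + \int[mu]_(t in `]x, +oo[) (f t)%:E)%E.
      rewrite -ge0_integral_setU//.
      - by rewrite -itv_bndbnd_setU// set_itvNyy.
      - by apply/measurable_EFinP; exact: measurable_funTS.
      - by move=> t _; rewrite lee_fin ltW.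
      - apply/disj_setPLR => z/=; rewrite !in_itv/= andbT => zx; apply/negP.
        by rewrite -leNgt.
    by rewrite -CE [X in (X - _)%E]addeC addeK.
  have := @ge0_nondecreasing_set_cvg_integral _ _ R
    (fun n : nat => `](- n%:R), +oo[ : set (measurableTypeR R)) (EFin \o f) mu.
  have -> : \bigcup_n (`](- n%:R), +oo[ : set R) = setT.
    rewrite -subTset => x _; exists (Num.bound `|x|) => //=; rewrite in_itv/= andbT.
    by rewrite ltrNl (le_lt_trans (ler_norm _))// normrN archi_boundP.
  move=> cv; suff : (I%:E <= (I - v)%:E)%E by rewrite lee_fin; lra.
  have {}cv : (\int[mu]_(x in `](- i%:R)%R, +oo[) (EFin \o f) x)%E @[i --> \oo] --> I%:E.
    rewrite IE; apply: cv => //.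
    - by move=> m n mn; apply/subsetPset/subset_itvr; rewrite bnd_simp lerN2 ler_nat.
    - by move=> n; apply/measurable_EFinP; exact: measurable_funTS.
    - by move=> n x _; rewrite lee_fin ltW.
  by apply: (cvge_le _ cv); near=> n; rewrite tailE lee_fin lerD2l lerN2.
move=> v /andP[v0 vI].
have [x Cx] := ex_lt v v0; have [y Cy] := ex_gt v vI.
have xy : x < y by rewrite -C_lt (lt_trans Cx).
have [|||z _ Cz] := @IVT R C x y v.
- exact: ltW.
- exact: continuous_subspaceT.
- by rewrite ge_min le_max (ltW Cx) (ltW Cy) orbT.
by exists z.
Unshelve. all: by end_near. Qed.

(** The map is u = C^-1 o D, for the cumulative functions C of [f] and D of [F]; equality of the
    total masses gives them the same range. Differentiating C(u x) = D x yields the last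
    identity. *)
Lemma transport_map (f F : R -> R) : continuous f -> continuous F ->
  (forall x, 0 < f x) -> (forall x, 0 < F x) ->
  mu.-integrable [set: R] (EFin \o f) -> mu.-integrable [set: R] (EFin \o F) ->
  (\int[mu]_t (f t)%:E = \int[mu]_t (F t)%:E)%E ->
  exists u du : R -> R, [/\ forall x : R, is_derive x 1%R u (du x), continuous du,
    forall x, 0 < du x, forall t, exists x, u x = t &
    forall x, f (u x) * du x = F x].
Proof.
move=> cf cF f0 F0 intf intF fF.
have [C [dC CI Csurj]] := cumulative cf f0 intf.
have [D [dD DI Dsurj]] := cumulative cF F0 intF.
rewrite -fF in DI Dsurj; set I := fine _ in CI Csurj DI Dsurj.
have C_lt := deriv_gt0_lt dC f0.
have C_inj : injective C.
  by move=> x y Cxy; case: (ltgtP x y) => //; rewrite -C_lt Cxy ltxx.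
have D_lt := deriv_gt0_lt dD F0.
have D_inj : injective D.
  by move=> x y Dxy; case: (ltgtP x y) => //; rewrite -D_lt Dxy ltxx.
(* The default 0 is taken only outside the range of [C], where [D] has no values. *)
pose Cinv v := xget 0 [set x | C x = v].
have CK : cancel C Cinv.
  by move=> x; apply: C_inj; rewrite /Cinv; case: xgetP => [y _ <-//|/(_ x)/=].
have u_ex x : C (Cinv (D x)) = D x.
  by have [y <-] := Csurj _ (DI x); rewrite CK.
pose u x := Cinv (D x).
have cC : continuous C.
  by move=> z; apply/differentiable_continuous/derivable1_diffP; case: (dC z).
have du (x : R) : is_derive x 1%R u (F x / f (u x)).
  have dinv : is_derive (D x) 1%R Cinv (f (u x))^-1.
    rewrite -u_ex; apply: (@is_derive_inverse R C Cinv (f (u x)) (u x)) => //.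
    - by near=> z; exact: CK.
    - by near=> z; exact: cC.
    - by rewrite gt_eqF.
  have := @is_derive1_comp R Cinv D x (f (u x))^-1 (F x) dinv (dD x).
  by rewrite mulrC.
have cu : continuous u.
  by move=> z; apply/differentiable_continuous/derivable1_diffP; case: (du z).
exists u, (fun x => F x / f (u x)); split => //.
- move=> x; apply: cvgM; first exact: cF.
  apply: cvgV; first by rewrite gt_eqF.
  exact: (cvg_comp u f (cu x) (@cf _)).
- by move=> x; rewrite divr_gt0.
- move=> t; have [x Dx] := Dsurj _ (CI t).
  by exists x; rewrite /u Dx CK.
- by move=> x; rewrite mulrCA divff ?mulr1// gt_eqF.
Unshelve. all: by end_near. Qed.
End transport.

(** * Maps y |-> sum_i u_i(<y, A_i>) A_i *)

Section orthonormal_columns.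
Context {R : realType}.
Local Open Scope classical_set_scope.

(** Far to the right of [q] one has u >= C, far to the left u <= -C. On the bounded stretch between
    [z] and [y], monotonicity compares u with u q, and [K] pays for the deficit. *)
Lemma mono_surj_coercive (u : R -> R) : {mono u : x y / x < y} ->
  (forall t, exists x, u x = t) -> forall q C, 0 <= C ->
  exists2 K, 0 <= K & forall x, C * `|x - q| - K <= u x * (x - q).
Proof.
move=> um us q C C0;
have u_le x y : x <= y -> u x <= u y.
  by rewrite le_eqVlt => /predU1P[->//|]; rewrite -um => /ltW.
have [xp xpC] := us C; have [xm xmC] := us (- C).
pose y := Num.max q xp; pose z := Num.min q xm.
have qy : q <= y by rewrite le_max lexx.
have zq : z <= q by rewrite ge_min lexx.
have K1 : 0 <= (`|u q| + C) * (y - q) by rewrite mulr_ge0 ?subr_ge0// addr_ge0.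
have K2 : 0 <= (`|u q| + C) * (q - z) by rewrite mulr_ge0 ?subr_ge0// addr_ge0.
exists ((`|u q| + C) * (y - q) + (`|u q| + C) * (q - z)); first exact: addr_ge0.
move=> x; have [qx|xq] := leP q x.
  rewrite ger0_norm ?subr_ge0//; have [yx|xy] := leP y x.
    have : C <= u x by rewrite -xpC u_le// (le_trans _ yx)// le_max lexx orbT.
    by move: qx; rewrite -subr_ge0 => qx Cu; nra.
  have h := u_le _ _ qx; have hq : - `|u q| <= u q by rewrite lerNl ler_normr lexx orbT.
  have : 0 <= `|u q| by [].
  move: qx xy; rewrite -subr_ge0 -subr_gt0 => qx xy; nra.
rewrite ltr0_norm ?subr_lt0//; have [xz|zx] := leP x z.
  have : u x <= - C by rewrite -xmC u_le// (le_trans xz)// ge_min lexx orbT.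
  by move: xq; rewrite -subr_gt0 => qx Cu; nra.
have h := u_le _ _ (ltW xq); have hq : u q <= `|u q| by exact: ler_norm.
have : 0 <= `|u q| by [].
move: xq zx; rewrite -subr_gt0 -(subr_gt0 z) => xq zx; nra.
Qed.

Variables (m k : nat) (A : 'M[R]_(m, k)) (c : 'rV[R]_m) (u du : 'I_m -> R -> R).
Hypothesis AA : A^T *m A = 1%:M.
Hypothesis dudu : forall i (x : R), is_derive x 1%R (u i) (du i x).
Hypothesis cdu : forall i, continuous (du i).
Hypothesis du0 : forall i x, 0 < du i x.
Hypothesis usurj : forall i t, exists x, u i x = t.

Definition coords (y : 'rV[R]_k) : 'rV[R]_m := c + y *m A^T.
Definition col_map (y : 'rV[R]_k) : 'rV[R]_k := (\row_i u i (coords y 0 i)) *m A.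
Definition dslope i (a b : R) : R :=
  if b == a then du i a else (u i b - u i a) / (b - a).
Definition col_slope (y z : 'rV[R]_k) : 'M[R]_k :=
  A^T *m diag_mx (\row_i dslope i (coords y 0 i) (coords z 0 i)) *m A.

Lemma u_mono i : {mono u i : x y / x < y}.
Proof. exact: (deriv_gt0_lt (dudu i) (du0 i)). Qed.

Lemma dslopeE i a b : u i b - u i a = (b - a) * dslope i a b.
Proof.
rewrite /dslope; case: eqVneq => [->|ba]; first by rewrite !subrr mul0r.
by rewrite mulrC divfK// subr_eq0.
Qed.

Lemma dslope_gt0 i a b : 0 < dslope i a b.
Proof.
rewrite /dslope; case: (ltgtP b a) => [ba|ab|//].
- by rewrite ltr_ndivlMr ?subr_lt0// mul0r subr_lt0 u_mono.
- by rewrite divr_gt0// subr_gt0// u_mono.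
Qed.

Lemma dslope_cvg i a : dslope i a b @[b --> a] --> du i a.
Proof.
have /is_derive1_caratheodory[g [gE cg ga]] := dudu i a.
rewrite -ga; suff -> : dslope i a = g by exact: cg.
apply/funext => b; rewrite /dslope; case: eqVneq => [->//|ba].
by rewrite gE mulfK// subr_eq0.
Qed.

Lemma coordsE y i : coords y 0 i = c 0 i + \sum_j y 0 j * A i j.
Proof. by rewrite !mxE; congr (_ + _); apply: eq_bigr => j _; rewrite mxE. Qed.

Lemma coords_cvg y i : coords z 0 i @[z --> y] --> coords y 0 i.
Proof.
under eq_fun do rewrite coordsE; rewrite coordsE.
apply: (cvgD (F := nbhs y)); first exact: cvg_cst.
apply: (cvg_sumr (F := nbhs y)) => j.
by apply: (cvgM (F := nbhs y)); [exact: coord_continuous|exact: cvg_cst].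
Qed.

Lemma coords_measurable i : row_measurable (fun y => coords y 0 i).
Proof.
move=> d S a ma; under eq_fun do rewrite /= coordsE.
apply: measurable_funD => //; apply: measurable_sum => j.
by apply: measurable_funM => //; exact: ma.
Qed.

Lemma col_slopeE y z i j : col_slope y z i j =
  \sum_l A l i * dslope l (coords y 0 l) (coords z 0 l) * A l j.
Proof.
rewrite mxE; apply: eq_bigr => l _; congr (_ * _).
by rewrite mul_mx_diag !mxE.
Qed.

Lemma rdot_adj (x : 'rV[R]_m) (h : 'rV[R]_k) : rdot (x *m A) h = rdot x (h *m A^T).
Proof.
rewrite /rdot; under eq_bigr do rewrite mxE mulr_suml.
rewrite exchange_big/=; apply: eq_bigr => i _; rewrite mxE mulr_sumr.
by apply: eq_bigr => j _; rewrite mxE mulrAC mulrA.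
Qed.

(** The form of [col_slope] at h is a positive diagonal form at [h *m A^T], and h |-> h A^T is
    injective because A^T A = 1. Coercivity is [mono_surj_coercive] summed over the coordinates. *)
Lemma slope_map_col : slope_map col_map col_slope.
Proof.
split.
- move=> y z; rewrite /col_map -mulmxBl /col_slope !mulmxA; congr (_ *m A).
  apply/rowP => i; rewrite mul_mx_diag !mxE dslopeE; congr (_ * _).
  rewrite opprD addrACA subrr add0r -sumrB.
  by apply: eq_bigr => j _; rewrite !mxE mulrBl.
- move=> y z h h0; rewrite /col_slope !mulmxA rdot_adj.
  have b0 : h *m A^T != 0.
    by apply: contra_neq h0 => hA; rewrite -[h]mulmx1 -AA mulmxA hA mul0mx.
  have [i bi] : exists i, (h *m A^T) 0 i != 0.
    apply: contrapT => no; move/eqP: b0; apply; apply/rowP => i; rewrite [RHS]mxE.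
    by apply/eqP; apply: contrapT => /negP bi; apply: no; exists i.
  rewrite /rdot (bigD1 i)//= mul_mx_diag ltr_wpDr//.
    apply: sumr_ge0 => j _; rewrite mxE [X in _ * X * _]mxE mulrAC -expr2.
    by rewrite mulr_ge0 ?sqr_ge0// ltW// dslope_gt0.
  rewrite mxE [X in _ * X * _]mxE mulrAC -expr2 mulr_gt0 ?dslope_gt0//.
  by rewrite lt0r sqrf_eq0 bi sqr_ge0.
- move=> y i j; under eq_fun do rewrite col_slopeE; rewrite col_slopeE.
  apply: (cvg_sumr (F := nbhs y)) => l.
  apply: (cvgM (F := nbhs y)); last exact: cvg_cst.
  apply: (cvgM (F := nbhs y)); first exact: cvg_cst.
  rewrite [X in _ --> X]/dslope eqxx.
  exact: (cvg_comp (fun z => coords z 0 l) (dslope l (coords y 0 l))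
    (@coords_cvg y l) (@dslope_cvg _ _)).
- move=> y i j; under eq_fun do rewrite col_slopeE; rewrite col_slopeE.
  apply: (cvg_sumr (F := nbhs y)) => l.
  apply: (cvgM (F := nbhs y)); last exact: cvg_cst.
  apply: (cvgM (F := nbhs y)); first exact: cvg_cst.
  under eq_fun do rewrite /dslope eqxx; rewrite /dslope eqxx.
  exact: (cvg_comp (fun z => coords z 0 l) (du l) (@coords_cvg y l) (@cdu _ _)).
- move=> i d S a ma; under eq_fun do rewrite /= mxE.
  apply: measurable_sum => l; apply: measurable_funM => //.
  under eq_fun do rewrite mxE.
  have mu_ : measurable_fun [set: R] (u l).
    apply: continuous_measurable_fun => z.
    by apply/differentiable_continuous/derivable1_diffP; case: (dudu l z).
  by apply: (measurableT_comp mu_); exact: coords_measurable.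
- move=> i j d S a ma; under eq_fun do rewrite /= col_slopeE.
  apply: measurable_sum => l; apply: measurable_funM => //; apply: measurable_funM => //.
  under eq_fun do rewrite /dslope eqxx.
  by apply: (measurableT_comp (continuous_measurable_fun (@cdu l))); exact: coords_measurable.
(* [kap] compares norms: Y - Z = (Y - Z) A^T A bounds the sup norm of Y - Z by [kap] times the l^1
   norm of (Y - Z) A^T. *)
- move=> Z C; pose kap := `|A| + 1; have kap0 : 0 < kap by rewrite ltr_wpDl.
  pose C' := kap * (`|C| + 1).
  have C'0 : 0 <= C' by rewrite mulr_ge0 ?ltW// addr_ge0.
  have /choice[K hK] : forall i, exists K, 0 <= K /\ forall x,
      C' * `|x - coords Z 0 i| - K <= u i x * (x - coords Z 0 i).
    move=> i; have [K K0 h] := mono_surj_coercive (u_mono i) (usurj i) (coords Z 0 i) C'0.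
    by exists K.
  (* The slope |C| + 1 exceeds what is needed by 1; the spare |Y| absorbs this whole threshold. *)
  exists ((`|C| + 1) * `|Z| + \sum_i K i) => Y hY.
  have dE i : ((Y - Z) *m A^T) 0 i = coords Y 0 i - coords Z 0 i.
    by rewrite mulmxBl /coords !mxE opprD addrACA subrr add0r.
  rewrite rdot_adj.
  have le1 : C' * (\sum_i `|((Y - Z) *m A^T) 0 i|) - \sum_i K i <=
      rdot (\row_i u i (coords Y 0 i)) ((Y - Z) *m A^T).
    rewrite mulr_sumr -sumrB; apply: ler_sum => i _.
    by rewrite mxE dE; exact: (hK i).2.
  apply: le_trans le1.
  have le2 : `|Y - Z| <= kap * \sum_i `|((Y - Z) *m A^T) 0 i|.
    rewrite norm_mxE; apply: bigmax_le => [|[i j] _ /=].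
      by rewrite mulr_ge0 ?(ltW kap0)// sumr_ge0.
    rewrite ord1 -[X in `|fun_of_matrix X _ _|]mulmx1 -AA mulmxA mxE.
    rewrite (le_trans (ler_norm_sum _ _ _))//.
    rewrite mulr_sumr; apply: ler_sum => l _; rewrite normrM mulrC ler_wpM2r//.
    by rewrite (le_trans (le_entry_mx_norm A l j))// lerDl.
  have le3 : `|Y| - `|Z| <= `|Y - Z| by exact: lerB_dist.
  have C1 : 0 < `|C| + 1 by rewrite ltr_wpDl.
  have le4 : (`|C| + 1) * (`|Y| - `|Z|) <= C' * \sum_i `|((Y - Z) *m A^T) 0 i|.
    rewrite /C' [kap * _]mulrC -mulrA ler_pM2l// (le_trans le3)//.
  have : C * `|Y| <= `|C| * `|Y| by rewrite ler_wpM2r// ler_norm.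
  move: le4 hY; rewrite mulrBr !mulrDl !mul1r; lra.
Qed.

Lemma det_col_slope y : \det (col_slope y y) =
  \det (A^T *m diag_mx (\row_i du i (coords y 0 i)) *m A).
Proof.
rewrite /col_slope; congr (\det (_ *m diag_mx _ *m _)).
by apply/rowP => i; rewrite !mxE /dslope eqxx.
Qed.

End orthonormal_columns.

(** * The transport argument *)

Section converse_hoelder.
Context {R : realType}.
Notation mu := (@lebesgue_measure R).
Local Open Scope ereal_scope.

(** Serves as an everywhere positive weight of finite integral; its product form lets the integral
    be computed one coordinate at a time. *)
Definition gauss_density k (b : 'rV[R]_k) : R := (\prod_j normal_pdf 0 1 (b 0%R j))%R.

Lemma gauss_density_gt0 k (b : 'rV[R]_k) : (0 < gauss_density b)%R.
Proof.
apply: prodr_gt0 => j _; rewrite normal_pdfE ?oner_eq0//.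
by rewrite mulr_gt0 ?normal_peak_gt0 ?oner_eq0 ?expR_gt0.
Qed.

Lemma gauss_density_measurable k : row_measurable (@gauss_density k).
Proof.
move=> d S a ma; apply: measurable_prod => j _.
by apply: (measurableT_comp (measurable_normal_pdf 0 1)).
Qed.

Lemma iint_gauss_density k : iint (fun b : 'rV[R]_k => (gauss_density b)%:E) = 1.
Proof.
elim: k => [|k IH] /=; first by rewrite /gauss_density big_ord0.
rewrite -(integral_normal_pdf 0 1); apply: eq_integral => t _.
rewrite -[RHS]mule1 -IH -iintZl.
- apply: eq_iint => v; rewrite -EFinM; congr EFin.
  rewrite /gauss_density big_ord_recl row_mx_scalarE unlift_none; congr (_ * _)%R.
  by apply: eq_bigr => j _; rewrite row_mx_scalarE liftK.
- exact: normal_pdf_ge0.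
- by move=> v; rewrite lee_fin ltW// gauss_density_gt0.
- by apply: row_measurable_EFin; exact: gauss_density_measurable.
Qed.

(* Tested on the truncations t_n = min(A^r, n w), with w an integrable positive
   weight so that the integral of t_n is finite and can be cancelled. *)
Lemma iint_converse_hoelder k (A : 'rV[R]_k -> \bar R) (r s : R) (X : \bar R) :
  (0 < r)%R -> (0 < s)%R -> (r^-1 + s^-1 = 1)%R ->
  (forall b, 0 < A b) -> row_measurable A -> 0 <= X ->
  (forall t : 'rV[R]_k -> R, (forall b, 0 < t b)%R -> row_measurable t ->
    iint (fun b => (t b)%:E) < +oo ->
    iint (fun b => A b * (t b `^ s^-1)%:E) <=
      X * poweR (iint (fun b => (t b)%:E)) s^-1) ->
  poweR (iint (fun b => poweR (A b) r)) r^-1 <= X.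
Proof.
move=> r0 s0 rs A0 mA; case: X => [x||] //; last by move=> *; exact: leey.
rewrite lee_fin => x0 hX.
have mAr : row_measurable (fun b => poweR (A b) r).
  by move=> d S a ma; apply: (measurableT_comp (measurable_poweR r)); exact: mA.
have Ar0 b : 0 < poweR (A b) r by exact: poweR_gt0.
(* The successor keeps the truncation positive at n = 0. *)
pose T n (b : 'rV[R]_k) := mine (poweR (A b) r) (n.+1%:R * gauss_density b)%:E.
have T0 n b : 0 < T n b.
  by rewrite lt_min Ar0 lte_fin mulr_gt0// gauss_density_gt0.
have Tle n b : T n b <= (n.+1%:R * gauss_density b)%:E by rewrite ge_min lexx orbT.
have Tfin n b : T n b \is a fin_num.
  by rewrite ge0_fin_numE ?ltW// (le_lt_trans (Tle n b))// ltry.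
have mT n : row_measurable (T n).
  move=> d S a ma; apply: measurable_mine; first exact: mAr.
  by apply/measurable_EFinP; apply: measurable_funM => //; exact: gauss_density_measurable.
pose t n b := fine (T n b).
have tE n b : (t n b)%:E = T n b by rewrite fineK.
have t0 n b : (0 < t n b)%R by rewrite -lte_fin tE.
have mt n : row_measurable (t n).
  by move=> d S a ma; apply: (measurableT_comp (fine_measurable _)) => //; exact: mT.
have Sle n : iint (T n) <= n.+1%:R%:E.
  rewrite -[leRHS]mule1 -(iint_gauss_density k) -iintZl//.
  - apply: le_iint => //.
    + by move=> b; exact: ltW.
    + move=> d S a ma; apply: measurable_funeM; apply/measurable_EFinP; exact: gauss_density_measurable.
  - by move=> v; rewrite lee_fin ltW// gauss_density_gt0.
  - by apply: row_measurable_EFin; exact: gauss_density_measurable.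
have S0 n : 0 < iint (T n) by exact: iint_gt0.
have Sx n : iint (T n) <= (x `^ r)%:E.
  have := hX (t n) (t0 n) (mt n).
  have -> : (fun b => (t n b)%:E) = T n by apply/funext.
  rewrite (le_lt_trans (Sle n)) ?ltry// => /(_ isT).
  (* T = T^(1/r) T^(1/s), and T^(1/r) <= A because T <= A^r. *)
  have low : iint (T n) <= iint (fun b => A b * (t n b `^ s^-1)%:E).
    apply: le_iint => //.
    - by move=> b; exact: ltW.
    - move=> d S a ma; apply: emeasurable_funM; first exact: mA.
      by apply: (row_measurable_EFin (row_measurable_powR s^-1 (mt n))).
    - move=> b; rewrite -tE -[X in X%:E](@powRr1 _ (t n b)) ?(ltW (t0 n b))// -rs.
      rewrite powRD; last by rewrite rs oner_eq0.
      rewrite EFinM; apply: lee_wpmul2r; first by rewrite lee_fin powR_ge0.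
      rewrite -poweR_EFin tE -[leRHS](poweRe1 (ltW (A0 b))) -(mulfV (lt0r_neq0 r0)).
      rewrite poweRrM; apply: gt0_ler_poweR.
      + by rewrite invr_ge0 ltW.
      + by rewrite in_itv/= leey andbT ltW.
      + by rewrite in_itv/= leey andbT ltW.
      + by rewrite ge_min lexx.
  move=> /(le_trans low); have := Sle n; have := S0 n.
  (* S is finite and positive, so S <= x S^(1/s) can be divided by S^(1/s), leaving S^(1/r) <= x. *)
  case: (iint (T n)) => [S||] //; rewrite !lte_fin poweR_EFin -EFinM !lee_fin => SS _ h.
  have hS : (S `^ r^-1 <= x)%R.
    rewrite -(ler_pM2r (powR_gt0 s^-1 SS)) -powRD; last by rewrite rs oner_eq0.
    by rewrite rs powRr1// ltW.
  rewrite -[leLHS](@powRr1 _ S) ?(ltW SS)// -(mulVf (lt0r_neq0 r0)) powRrM.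
  by apply: ge0_ler_powR; rewrite ?nnegrE ?powR_ge0 ?(ltW r0).
have Tnd b : nondecreasing_seq (T^~ b).
  move=> m n mn; rewrite /T le_min; apply/andP; split.
    by rewrite ge_min lexx.
  apply: (le_trans (Tle m b)); rewrite lee_fin ler_wpM2r ?ler_nat//.
  exact/ltW/gauss_density_gt0.
have limT b : limn (T^~ b) = poweR (A b) r.
  apply/cvg_lim => //; have w0 := gauss_density_gt0 b.
  case AE : (poweR (A b) r) (Ar0 b) => [a||] // a0.
    have : (cst (poweR (A b) r) @ \oo --> a%:E)%classic by rewrite AE; exact: cvg_cst.
    apply: cvg_trans; apply: near_eq_cvg; near=> n.
    rewrite /T AE /= min_l// lee_fin -ler_pdivrMr//.
    apply: (@le_trans _ _ n%:R); last by rewrite ler_nat.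
    by near: n; exact: nbhs_infty_ger.
  apply/cvgeyPge => a; near=> n.
  rewrite /T AE min_r ?leey// lee_fin -ler_pdivrMr//.
  apply: (@le_trans _ _ n%:R); last by rewrite ler_nat.
  by near: n; exact: nbhs_infty_ger.
have -> : iint (fun b => poweR (A b) r) = limn (fun n => iint (T n)).
  rewrite -iint_monotone_convergence//.
  - by apply: eq_iint => b; rewrite limT.
  - by move=> n v; exact: ltW.
have le_x : limn (fun n => iint (T n)) <= (x `^ r)%:E.
  apply: lime_le; last by near=> n; exact: Sx.
  apply: ereal_nondecreasing_is_cvgn => m n mn; apply: le_iint => //.
    by move=> b; exact: ltW.
  by move=> v; exact: Tnd.
have -> : x%:E = poweR (x `^ r)%:E r^-1.
  by rewrite poweR_EFin -powRrM mulfV ?gt_eqF// powRr1.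
apply: gt0_ler_poweR => //.
- by rewrite invr_ge0 ltW.
- rewrite in_itv/= leey andbT; apply: lime_ge.
    apply: ereal_nondecreasing_is_cvgn => m n mn; apply: le_iint => //.
      by move=> b; exact: ltW.
    by move=> v; exact: Tnd.
  by near=> n; exact: ltW.
- by rewrite in_itv/= leey andbT lee_fin powR_ge0.
Unshelve. all: by end_near. Qed.
End converse_hoelder.

(** * The bound for a fixed dual weight *)

Section barthe.
Context {R : realType}.
Variables (n d : nat) (V : 'M[R]_(n + d)) (r : R) (p : 'I_(n + d) -> R) (D : R).
Hypothesis VV : V *m V^T = 1%:M.
Hypothesis r1 : 1 < r.
Hypothesis p1 : forall i, 1 < p i.

Let s := conj_exp r.

Lemma conj_exp_gt0 (t : R) : 1 < t -> 0 < conj_exp t.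
Proof. by move=> t1; rewrite divr_gt0// ?subr_gt0// (lt_trans ltr01). Qed.

Lemma conj_expV (t : R) : 1 < t -> (conj_exp t)^-1 = 1 - t^-1.
Proof.
move=> t1; rewrite /conj_exp invf_div mulrBl divff ?mul1r//.
by rewrite gt_eqF// (lt_trans ltr01).
Qed.

Let W := rsubmx V.
Let L := lsubmx V.

Lemma VtV : V^T *m V = 1%:M.
Proof. exact: mulmx1C. Qed.

Lemma WtW : W^T *m W = 1%:M.
Proof.
have := VtV; rewrite -{1 2}[V]hsubmxK tr_row_mx mul_col_row scalar_mx_block.
by move=> /eq_block_mx[].
Qed.

Lemma ipE a b i : ip V a b i = (row_mx a b *m V^T) 0 i.
Proof. by rewrite /ip mxE; apply: eq_bigr => j _; congr (_ * _); rewrite mxE. Qed.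

Lemma row_mx_VT (a : 'rV[R]_n) (b : 'rV[R]_d) :
  row_mx a b *m V^T = a *m L^T + b *m W^T.
Proof. by rewrite -{1}[V]hsubmxK tr_row_mx mul_row_col. Qed.

Definition ipprod (g : 'I_(n + d) -> R -> R) (e : 'I_(n + d) -> R) a b : R :=
  \prod_i g i (ip V a b i) `^ e i.

Lemma measurable_ip dS (S : measurableType dS) (a : S -> 'rV[R]_n) (b : S -> 'rV[R]_d) i :
  (forall j, measurable_fun setT (fun x => a x 0 j)) ->
  (forall j, measurable_fun setT (fun x => b x 0 j)) ->
  measurable_fun setT (fun x => ip V (a x) (b x) i).
Proof.
move=> ma mb; apply: measurable_sum => j; apply: measurable_funM => //.
by under eq_fun do rewrite mxE; case: (fintype.split j).
Qed.

Lemma measurable_ipprod g e dS (S : measurableType dS) (a : S -> 'rV[R]_n)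
    (b : S -> 'rV[R]_d) : (forall i, continuous (g i)) ->
  (forall j, measurable_fun setT (fun x => a x 0 j)) ->
  (forall j, measurable_fun setT (fun x => b x 0 j)) ->
  measurable_fun setT (fun x => ipprod g e (a x) (b x)).
Proof.
move=> cg ma mb; apply: measurable_prod => i _.
apply: (measurableT_comp (@measurable_powR R (e i))).
by apply: (measurableT_comp (continuous_measurable_fun (@cg i))); exact: measurable_ip.
Qed.

Lemma ipprod_gt0 g e a b : (forall i x, 0 < g i x) -> 0 < ipprod g e a b.
Proof. by move=> g0; apply: prodr_gt0 => i _; rewrite powR_gt0. Qed.

Lemma powR_prod (I : Type) (q : seq I) (g : I -> R) (e : R) : (forall i, 0 <= g i) ->
  (\prod_(i <- q) g i) `^ e = \prod_(i <- q) g i `^ e.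
Proof.
move=> g0; elim: q => [|i q IH]; first by rewrite !big_nil powR1.
by rewrite !big_cons powRM ?IH// prodr_ge0.
Qed.

Lemma ipprod_powR g e a b q : (forall i x, 0 < g i x) ->
  ipprod g e a b `^ q = ipprod g (fun i => e i * q) a b.
Proof.
move=> g0; rewrite /ipprod powR_prod; last by move=> i; exact: powR_ge0.
by apply: eq_bigr => i _; rewrite powRrM.
Qed.

Variables (f F u du : 'I_(n + d) -> R -> R).
Hypothesis D0 : 0 < D.
Hypothesis Dineq : det_ineq V r p D.
Hypothesis cf : forall i, continuous (f i).
Hypothesis cF : forall i, continuous (F i).
Hypothesis f0 : forall i x, 0 < f i x.
Hypothesis F0 : forall i x, 0 < F i x.
Hypothesis dudu : forall i (x : R), is_derive x 1%R (u i) (du i x).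
Hypothesis cdu : forall i, continuous (du i).
Hypothesis du0 : forall i x, 0 < du i x.
Hypothesis usurj : forall i t, exists x, u i x = t.
Hypothesis fu : forall i x, f i (u i x) * du i x = F i x.

Let Theta := col_map V 0 u.
Let Phi a := col_map W (a *m L^T) u.

Lemma coords_row_mx a b i : coords V 0 (row_mx a b) 0 i = ip V a b i.
Proof. by rewrite /coords add0r ipE. Qed.

Lemma coords_W a b i : coords W (a *m L^T) b 0 i = ip V a b i.
Proof. by rewrite ipE row_mx_VT. Qed.

Lemma rsubmx_Theta a b : rsubmx (Theta (row_mx a b)) = Phi a b.
Proof.
rewrite /Theta /Phi /col_map -mulmx_rsub; congr (_ *m _).
by apply/rowP => i; rewrite [LHS]mxE [RHS]mxE coords_row_mx coords_W.
Qed.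

(** The rows of [V] are an orthonormal basis, in which [Theta] acts coordinate by coordinate through
    the [u i]. *)
Lemma ip_Theta a b i :
  ip V (lsubmx (Theta (row_mx a b))) (rsubmx (Theta (row_mx a b))) i = u i (ip V a b i).
Proof.
rewrite ipE hsubmxK /Theta /col_map -mulmxA VV mulmx1 mxE.
by rewrite coords_row_mx.
Qed.

Lemma det_Theta a b : \det (col_slope V 0 u du (row_mx a b) (row_mx a b)) =
  \prod_i du i (ip V a b i).
Proof.
rewrite det_col_slope !det_mulmx det_diag mulrAC -det_mulmx VtV det1 mul1r.
by apply: eq_bigr => i _; rewrite mxE coords_row_mx.
Qed.

Let pV i := (p i)^-1.
Let qV i := 1 - (p i)^-1.

(** The Jacobian factor u_i' splits into its powers 1/p_i and 1/p_i'; the first turns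
    f_i(u_i)^(1/p_i) into F_i^(1/p_i). *)
Lemma ipprod_Theta a b :
  ipprod f pV (lsubmx (Theta (row_mx a b))) (rsubmx (Theta (row_mx a b))) *
    \prod_i du i (ip V a b i) = ipprod F pV a b * ipprod du qV a b.
Proof.
rewrite /ipprod -!big_split/=; apply: eq_bigr => i _; rewrite ip_Theta -fu.
rewrite powRM ?ltW// -mulrA; congr (_ * _).
have pq : pV i + qV i = 1 by rewrite /qV addrC subrK.
by rewrite -powRD pq ?oner_eq0// powRr1// ltW.
Qed.

(** This is [det_ineq] at lambda_i = u_i'(<X, v_i>): raising the powers 1/p_i' to r' gives exactly
    its exponents. *)
Lemma det_Phi_ge a b : ipprod du qV a b `^ s <=
  D^-1 * \det (col_slope W (a *m L^T) u du b b).
Proof.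
rewrite det_col_slope ler_pdivlMl// ipprod_powR//.
have h := Dineq (lam := \row_i du i (coords W (a *m L^T) b 0 i)).
apply: le_trans (h _); last by move=> i; rewrite mxE.
rewrite ler_pM2l// /ipprod le_eqVlt; apply/orP; left; apply/eqP.
apply: eq_bigr => i _; rewrite mxE coords_W; congr (_ `^ _).
by rewrite /qV conj_expV// mulrC.
Qed.

Local Open Scope ereal_scope.

Lemma transport_bound (t : 'rV[R]_d -> R) : (forall b, 0 < t b)%R -> row_measurable t ->
  iint (fun b => (t b)%:E) < +oo ->
  iint (fun b => iint (fun a => (ipprod f pV a b)%:E) * (t b `^ s^-1)%:E) <=
    (D `^ (- s^-1))%:E * iint (fun a => poweR (iint (fun b =>
      (ipprod F (fun i => r / p i)%R a b)%:E)) r^-1) *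
    poweR (iint (fun b => (t b)%:E)) s^-1.
Proof.
move=> t0 mt tfin.
have r0 : (0 < r)%R by rewrite (lt_trans ltr01).
have s0 : (0 < s)%R by exact: conj_exp_gt0.
have rs : (r^-1 + s^-1 = 1)%R by rewrite conj_expV// addrC subrK.
have S0 : 0 < iint (fun b => (t b)%:E) by apply: iint_gt0 => //; exact: row_measurable_EFin.
have [S SE] : exists S, iint (fun b => (t b)%:E) = S%:E.
  by exists (fine (iint (fun b => (t b)%:E))); rewrite fineK// ge0_fin_numE// ltW.
rewrite SE lte_fin in S0; rewrite SE poweR_EFin.
pose H b := (t b `^ s^-1)%R.
have H0 b : (0 < H b)%R by exact: powR_gt0.
have mH : row_measurable H by exact: row_measurable_powR.
have mlr k l dS (T : measurableType dS) (x : T -> 'rV[R]_(k + l)) :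
    (forall j, measurable_fun setT (fun y => x y 0%R j)) ->
    (forall j, measurable_fun setT (fun y => lsubmx (x y) 0%R j)) *
    (forall j, measurable_fun setT (fun y => rsubmx (x y) 0%R j)).
  by move=> mx; split => j; under eq_fun do rewrite mxE; exact: mx.
pose G (x : 'rV[R]_(n + d)) := (ipprod f pV (lsubmx x) (rsubmx x) * H (rsubmx x))%:E.
have mG : row_measurable G.
  move=> dS T x mx; apply/measurable_EFinP; have [ml mr] := mlr _ _ _ _ _ mx.
  by apply: measurable_funM; [exact: measurable_ipprod|exact: mH].
have G0 x : 0 <= G x by rewrite lee_fin mulr_ge0 ?ltW// ipprod_gt0.
have -> : iint (fun b => iint (fun a => (ipprod f pV a b)%:E) * (H b)%:E) = iint G.
  transitivity (iint (fun b : 'rV[R]_d => iint (fun a : 'rV[R]_n => G (row_mx a b)))).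
    apply: eq_iint => b; rewrite muleC -iintZl.
    - by apply: eq_iint => a; rewrite /G row_mxKl row_mxKr mulrC.
    - exact: ltW.
    - by move=> a; rewrite lee_fin ltW// ipprod_gt0.
    - by move=> dS T a ma; apply/measurable_EFinP; apply: measurable_ipprod.
  rewrite iint_exchange//; last first.
    move=> dS T x mx; have [ml mr] := mlr _ _ _ _ _ mx.
    apply: mG => j; under eq_fun do rewrite mxE.
    by case: (fintype.split j).
  by rewrite -(iint_split G).
rewrite -(iint_slope_map (slope_map_col 0 VtV dudu cdu du0 usurj) G0 mG) -/Theta.
pose g a b := (ipprod du qV a b * H (Phi a b))%R.
have g0 a b : (0 < g a b)%R by rewrite mulr_gt0// ipprod_gt0.
have sPhi a : slope_map (Phi a) (col_slope W (a *m L^T) u du).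
  exact: slope_map_col WtW _ _ _ _.
have mg a : row_measurable (g a).
  move=> dS T b mb; apply: measurable_funM.
    by apply: measurable_ipprod => // j.
  by apply: mH => j; exact: (slope_map_measurable (sPhi a)).
have mPF a : row_measurable (ipprod F pV a).
  by move=> dS T b mb; apply: measurable_ipprod => // j.
have PF0 a b : (0 < ipprod F pV a b)%R by exact: ipprod_gt0.
rewrite iint_split.
have -> : iint (fun a => iint (fun b => G (Theta (row_mx a b)) *
    (\det (col_slope V 0%R u du (row_mx a b) (row_mx a b)))%:E)) =
    iint (fun a => iint (fun b => (ipprod F pV a b * g a b)%:E)).
  apply: eq_iint => a; apply: eq_iint => b.
  by rewrite det_Theta /G -EFinM mulrAC ipprod_Theta rsubmx_Theta -mulrA.
pose B := (D^-1 * S)%R.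
have B0 : (0 < B)%R by rewrite mulr_gt0// invr_gt0.
have gB a : iint (fun b => (g a b `^ s)%:E) <= B%:E.
  have <- : D^-1%:E * iint (fun b => (t (Phi a b))%:E *
      (\det (col_slope W (a *m L^T) u du b b))%:E) = B%:E.
    rewrite (iint_slope_map (G := fun b => (t b)%:E) (sPhi a)) ?SE//.
    - by move=> b; rewrite lee_fin ltW.
    - exact: row_measurable_EFin.
  have mdet : row_measurable (fun b => \det (col_slope W (a *m L^T) u du b b)).
    by move=> dS T b mb; apply: measurable_det => i j; apply: (slope_diag_measurable (sPhi a)).
  have det0 b : (0 <= \det (col_slope W (a *m L^T) u du b b))%R.
    by apply/ltW/posdef_det; exact: (slope_pos (sPhi a)).
  have mtPhi : row_measurable (fun b => (t (Phi a b))%:E *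
      (\det (col_slope W (a *m L^T) u du b b))%:E).
    move=> dS T b mb; apply: emeasurable_funM; apply/measurable_EFinP.
      by apply: mt => j; exact: (slope_map_measurable (sPhi a)).
    exact: mdet.
  rewrite -iintZl ?invr_ge0 ?(ltW D0)//; last first.
    by move=> b; rewrite -EFinM lee_fin mulr_ge0// ltW.
  apply: le_iint => //.
  - by move=> b; rewrite lee_fin powR_ge0.
  - by apply: row_measurable_EFin; exact: row_measurable_powR.
  - by move=> dS T b mb; apply: measurable_funeM; exact: mtPhi.
  - move=> b; rewrite -!EFinM lee_fin /g /H powRM ?powR_ge0 ?(ltW (ipprod_gt0 _ _ _ du0))//.
    rewrite -powRrM mulVf ?gt_eqF// powRr1 ?(ltW (t0 _))// mulrCA mulrC ler_pM2l//.
    exact: det_Phi_ge.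
have FrE a : iint (fun b => (ipprod F pV a b `^ r)%:E) =
    iint (fun b => (ipprod F (fun i => r / p i)%R a b)%:E).
  apply: eq_iint => b; rewrite ipprod_powR//; congr EFin.
  by apply: eq_bigr => i _; rewrite mulrC.
have mFr a : row_measurable (fun b => (ipprod F (fun i => r / p i)%R a b)%:E).
  by move=> dS T b mb; apply/measurable_EFinP; apply: measurable_ipprod => // j.
have Fr0 a : 0 < iint (fun b => (ipprod F (fun i => r / p i)%R a b)%:E).
  by apply: iint_gt0 => // b; rewrite lte_fin ipprod_gt0.
have mJ : row_measurable (fun a => poweR (iint (fun b =>
    (ipprod F (fun i => r / p i)%R a b)%:E)) r^-1).
  move=> dS T a ma; apply: (measurableT_comp (measurable_poweR r^-1)).
  apply: (row_measurable_iint (g := fun a b => (ipprod F (fun i => r / p i)%R a b)%:E)) => //.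
    by move=> v w; rewrite lee_fin ltW// ipprod_gt0.
  move=> dS' T' x mx; have [ml mr] := mlr _ _ _ _ _ mx.
  by apply/measurable_EFinP; exact: measurable_ipprod.
(* Hoelder in b for each fixed a; since [B] is uniform in a, its power then leaves the outer
   integral. *)
apply: (@le_trans _ _ (iint (fun a => (B `^ s^-1)%:E * poweR (iint (fun b =>
    (ipprod F (fun i => r / p i)%R a b)%:E)) r^-1))).
  apply: le_iint.
  - by move=> a; apply: iint_ge0 => b; rewrite lee_fin ltW// mulr_gt0.
  - apply: (row_measurable_iint (g := fun a b => (ipprod F pV a b * g a b)%:E)).
      by move=> a b; rewrite lee_fin ltW// mulr_gt0.
    move=> dS T x mx; have [ml mr] := mlr _ _ _ _ _ mx; apply/measurable_EFinP.
    apply: measurable_funM; first exact: measurable_ipprod.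
    apply: measurable_funM; first exact: measurable_ipprod.
    apply: mH => j; under eq_fun do rewrite -rsubmx_Theta hsubmxK mxE.
    exact: (slope_map_measurable (slope_map_col 0 VtV dudu cdu du0 usurj)).
  - by move=> dS T a ma; apply: measurable_funeM; exact: mJ.
  - move=> a; rewrite muleC -FrE.
    apply: (iint_hoelder r0 s0 rs) => //.
    + by move=> b; exact: ltW.
    + by move=> b; exact: ltW.
    + by rewrite FrE.
rewrite iintZl ?powR_ge0//; last by move=> a; exact: poweR_ge0.
rewrite /B powRM ?invr_ge0 ?(ltW D0) ?(ltW S0)// EFinM.
by rewrite (powRV D0 erefl) -powRN muleAC.
Qed.
End barthe.

Theorem theorem7 (R : realType) (n d : nat) (V : 'M[R]_(n + d))
  (r : R) (p : 'I_(n + d) -> R) (D : R)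
  (f F : 'I_(n + d) -> R -> R) :
  V *m V^T = 1%:M ->
  1 < r -> (forall i, 1 < p i) ->
  \sum_(i < n + d) (p i)^-1 = n%:R + d%:R / r ->
  0 <= D -> det_ineq V r p D ->
  (forall D', 0 <= D' -> det_ineq V r p D' -> D' <= D) ->
  (forall i, continuous (f i)) -> (forall i, continuous (F i)) ->
  (forall i x, 0 < f i x) -> (forall i x, 0 < F i x) ->
  (forall i, (@lebesgue_measure R).-integrable [set: R] (EFin \o f i)) ->
  (forall i, (@lebesgue_measure R).-integrable [set: R] (EFin \o F i)) ->
  (forall i, (\int[@lebesgue_measure R]_(t in [set: R]) (f i t)%:E
             = \int[@lebesgue_measure R]_(t in [set: R]) (F i t)%:E)%E) ->
  (poweR
     (iint (fun b : 'rV[R]_d =>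
        poweR (iint (fun a : 'rV[R]_n =>
                 (\prod_(i < n + d) f i (ip V a b i) `^ (p i)^-1)%:E)) r))
     r^-1
   <= (if D == 0%R then +oo else (D `^ (- (conj_exp r)^-1))%:E) *
      iint (fun a : 'rV[R]_n =>
        poweR (iint (fun b : 'rV[R]_d =>
                 (\prod_(i < n + d) F i (ip V a b i) `^ (r / p i))%:E)) r^-1))%E.
Proof.
move=> VV r1 p1 _ D_ge0 Dineq _ cf cF f0 F0 intf intF fF.
pose I := iint (fun a : 'rV[R]_n => poweR (iint (fun b : 'rV[R]_d =>
  (ipprod V F (fun i => r / p i) a b)%:E)) r^-1).
have r0 : 0 < r by rewrite (lt_trans ltr01).
have s0 : 0 < conj_exp r by exact: conj_exp_gt0.
have rs : r^-1 + (conj_exp r)^-1 = 1 by rewrite conj_expV// addrC subrK.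
have I0 : (0 < I)%E.
  apply: iint_gt0 => [a|].
    apply: poweR_gt0; apply: iint_gt0 => [b|]; first by rewrite lte_fin ipprod_gt0.
    by move=> dS T b mb; apply/measurable_EFinP; apply: measurable_ipprod => // j.
  move=> dS T a ma; apply: (measurableT_comp (measurable_poweR r^-1)).
  apply: (row_measurable_iint (g := fun a b => (ipprod V F (fun i => r / p i) a b)%:E)) => //.
    by move=> v w; rewrite lee_fin ltW// ipprod_gt0.
  move=> dS' T' x mx; apply/measurable_EFinP; apply: measurable_ipprod => // j;
    by under eq_fun do rewrite mxE; exact: mx.
(* For D = 0 the right-hand side is +oo only because [I] is positive: a zero integral would make the
   product 0. *)
rewrite -/I; case: eqVneq => [_|D_neq0]; first by rewrite gt0_mulye// leey.
have D0 : 0 < D by rewrite lt0r D_neq0.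
have /choice[U hU] : forall i, exists U : (R -> R) * (R -> R),
    [/\ forall x : R, is_derive x 1%R U.1 (U.2 x), continuous U.2,
      forall x, 0 < U.2 x, forall t, exists x, U.1 x = t &
      forall x, f i (U.1 x) * U.2 x = F i x].
  move=> i; have [u [du h]] := transport_map (cf i) (cF i) (f0 i) (F0 i) (intf i) (intF i) (fF i).
  by exists (u, du).
have A0 b : (0 < iint (fun a : 'rV[R]_n => (ipprod V f (fun i => (p i)^-1) a b)%:E))%E.
  apply: iint_gt0 => [a|]; first by rewrite lte_fin ipprod_gt0.
  by move=> dS T a ma; apply/measurable_EFinP; apply: measurable_ipprod => // j.
apply: (iint_converse_hoelder r0 s0 rs A0).
- apply: (row_measurable_iint (g := fun b a => (ipprod V f (fun i => (p i)^-1) a b)%:E)).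
    by move=> v w; rewrite lee_fin ltW// ipprod_gt0.
  move=> dS T x mx; apply/measurable_EFinP; apply: measurable_ipprod => // j;
    by under eq_fun do rewrite mxE; exact: mx.
- by rewrite mule_ge0 ?lee_fin ?powR_ge0// ltW.
move=> t t0 mt tfin.
apply: (@transport_bound R n d V r p D VV r1 p1 f F (fun i => (U i).1) (fun i => (U i).2)) => // i;
  by case: (hU i).
Qed.
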